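(* Let $\gamma$ be the (strict) Lie 2-algebra of a crossed module of Lie groups and $\mathcal P$ a Lie groupoid. The graded product $[\,\cdot\wedge\cdot\,]$ equips $\gamma$-valued differential forms on $\mathcal P$ with the structure of a differential graded Lie algebra, i.e. for $\Psi\in\Omega^k(\mathcal P,\gamma)$, $\Phi\in\Omega^l(\mathcal P,\gamma)$ and $\Xi\in\Omega^i(\mathcal P,\gamma)$: (a) $[\Phi\wedge\Psi]=-(-1)^{kl}[\Psi\wedge\Phi]$; (b) $(-1)^{ki}[[\Psi\wedge\Phi]\wedge\Xi]+(-1)^{li}[[\Xi\wedge\Psi]\wedge\Phi]+(-1)^{kl}[[\Phi\wedge\Xi]\wedge\Psi]=0$; (c) $\mathrm D[\Psi\wedge\Phi]=[\mathrm D\Psi\wedge\Phi]+(-1)^k[\Psi\wedge\mathrm D\Phi]$.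
   Context: A strict Lie 2-algebra $\gamma=(\mathfrak h,\mathfrak g,t_*,\alpha_* )$ consists of Lie algebras $\mathfrak g,\mathfrak h$, a Lie algebra homomorphism $t_*:\mathfrak h\to\mathfrak g$, and an action $\alpha_*:\mathfrak g\times\mathfrak h\to\mathfrak h$ of $\mathfrak g$ on $\mathfrak h$ by derivations (bilinear) with $\alpha_*(t_*(Y_1),Y_2)=[Y_1,Y_2]$ and $t_*\alpha_*(X,Y)=[X,t_*(Y)]$. For a Lie groupoid $\mathcal P$ with source and target $s,t:\mathrm{Mor}(\mathcal P)\to\mathrm{Obj}(\mathcal P)$ and composition $c$ on composable pairs $\mathrm{Mor}(\mathcal P)\,{}_s\!\times_t\mathrm{Mor}(\mathcal P)$, put $\Delta=t^*-s^*$ on forms on $\mathrm{Obj}(\mathcal P)$ and $\Delta=\mathrm{pr}_1^*-c^*+\mathrm{pr}_2^*$ on forms on $\mathrm{Mor}(\mathcal P)$. A $p$-form $\Psi\in\Omega^p(\mathcal P,\gamma)$ is a triple $\Psi=(\Psi^a,\Psi^b,\Psi^c)$ with $\Psi^a\in\Omega^p(\mathrm{Obj}(\mathcal P),\mathfrak g)$, $\Psi^b\in\Omega^p(\mathrm{Mor}(\mathcal P),\mathfrak h)$, $\Psi^c\in\Omega^{p+1}(\mathrm{Obj}(\mathcal P),\mathfrak h)$ such that $\Delta\Psi^a=t_*(\Psi^b)$ and $\Delta\Psi^b=0$. The differential $\mathrm D:\Omega^p(\mathcal P,\gamma)\to\Omega^{p+1}(\mathcal P,\gamma)$ is $(\mathrm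 D\Psi)^a=\mathrm d\Psi^a-(-1)^pt_*(\Psi^c)$, $(\mathrm D\Psi)^b=\mathrm d\Psi^b-(-1)^p\Delta(\Psi^c)$, $(\mathrm D\Psi)^c=\mathrm d\Psi^c$. For $\Psi\in\Omega^k(\mathcal P,\gamma)$, $\Phi\in\Omega^l(\mathcal P,\gamma)$, the product $[\Psi\wedge\Phi]\in\Omega^{k+l}(\mathcal P,\gamma)$ is $[\Psi\wedge\Phi]^a=[\Psi^a\wedge\Phi^a]$, $[\Psi\wedge\Phi]^b=[\Psi^b\wedge\Phi^b]+\alpha_*(s^*\Psi^a\wedge\Phi^b)-(-1)^{kl}\alpha_*(s^*\Phi^a\wedge\Psi^b)$, $[\Psi\wedge\Phi]^c=\alpha_*(\Psi^a\wedge\Phi^c)-(-1)^{kl}\alpha_*(\Phi^a\wedge\Psi^c)$, where $\alpha_*(\omega\wedge\eta)$ and $[\omega\wedge\eta]$ on ordinary forms are wedge products combined with the bilinear maps $\alpha_*$ and the Lie bracket. *)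

(* Defs.v *)
From HB Require Import structures.
From mathcomp Require Import all_boot all_order all_fingroup all_algebra.
From mathcomp Require Import all_classical all_reals all_analysis.

Set Implicit Arguments.
Unset Strict Implicit.
Unset Printing Implicit Defensive.

Import Order.TTheory GRing.Theory Num.Theory.
Import numFieldNormedType.Exports.

Local Open Scope classical_set_scope.
Local Open Scope ring_scope.

(* Class C^k on a set U; only used for open U. *)
Fixpoint Ck_on (R : realType) (n : nat) (W : normedModType R) (k : nat)
    (U : set 'rV[R]_n) (f : 'rV[R]_n -> W) : Prop :=
  match k with
  | 0%N => {in U, continuous f}
  | k'.+1 => (forall u, U u -> differentiable f u) /\
             (forall w : 'rV[R]_n, Ck_on k' U ('D_w f))
  end.

Definition smooth_on (R : realType) (n : nat) (W : normedModType R)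
    (U : set 'rV[R]_n) (f : 'rV[R]_n -> W) : Prop :=
  forall k, Ck_on k U f.

(* A finite-dimensional V carries no canonical norm in the library, so
   analysis of V-valued functions is done in coordinates; the choice of basis
   does not matter. *)
Definition coords (R : realType) (V : vectType R) : V -> 'rV[R]_(\dim {:V}) :=
  passmx.rVof (vbasis {:V}).

Definition of_coords (R : realType) (V : vectType R) :
    'rV[R]_(\dim {:V}) -> V :=
  passmx.vecof (vbasis {:V}).

Definition vderive (R : realType) (n : nat) (V : vectType R)
    (f : 'rV[R]_n -> V) (u w : 'rV[R]_n) : V :=
  of_coords ('D_w (fun u' => coords (f u')) u).

(* [cinv] is the inverse of [cmap] on [cmap @` cdom]; values of [cmap] outside
   [cdom] and of [cinv] outside [cmap @` cdom] are irrelevant. *)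
Record chart (R : realType) (M : topologicalType) (n : nat) := Chart {
  cdom : set M;
  cmap : M -> 'rV[R]_n;
  cinv : 'rV[R]_n -> M;
  cdom_open : open cdom;
  cimg_open : open (cmap @` cdom);
  cmapK : forall x, cdom x -> cinv (cmap x) = x;
  cmap_continuous : {in cdom, continuous cmap};
  cinv_continuous : {in cmap @` cdom, continuous cinv} }.

Record smooth_structure (R : realType) (M : topologicalType) (n : nat) :=
  SmoothStructure {
  atlas : set (chart R M n);
  atlas_cover : forall x : M, exists2 c, atlas c & cdom c x;
  atlas_smooth : forall c c', atlas c -> atlas c' ->
    smooth_on (cmap c @` (cdom c `&` cdom c')) (cmap c' \o cinv c);
  smooth_hausdorff : hausdorff_space M;
  smooth_second_countable : @second_countable M }.

Record manifold (R : realType) := Manifold {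
  mcarrier :> topologicalType;
  mdim : nat;
  mstruct : smooth_structure R mcarrier mdim }.

Definition matlas (R : realType) (M : manifold R) : set (chart R M (mdim M)) :=
  atlas (mstruct M).

(* A chosen chart around each point. The tangent space T_x M is represented by
   R^(mdim M), a tangent vector being given by its components in the chart
   [chart_at x]. All notions below are invariant under the choice. *)
Definition chart_at (R : realType) (M : manifold R) (x : M) :
    chart R M (mdim M) :=
  s2val (cid2 (atlas_cover (mstruct M) x)).

Notation tangent M := ('rV_(mdim M)).

Definition smooth_map (R : realType) (M N : manifold R) (f : M -> N) : Prop :=
  continuous f /\
  forall c c', matlas c -> matlas c' ->
    smooth_on (cmap c @` (cdom c `&` f @^-1` cdom c')) (cmap c' \o f \o cinv c).

(* The tangent map T_x M -> T_(f x) N. *)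
Definition mdiff (R : realType) (M N : manifold R) (f : M -> N) (x : M) :
    'rV[R]_(mdim M) -> 'rV[R]_(mdim N) :=
  'd (cmap (chart_at (f x)) \o f \o cinv (chart_at x)) (cmap (chart_at x) x).

Definition submersion (R : realType) (M N : manifold R) (f : M -> N) : Prop :=
  smooth_map f /\ forall x (w : tangent N), exists v : tangent M, mdiff f x v = w.

(* Families of functions (T_x M)^p -> V, x in M; they are V-valued p-forms when
   they satisfy [is_form] below. *)
Definition preform (R : realType) (M : manifold R) (V : vectType R) (p : nat) :
  Type := M -> ('I_p -> 'rV[R]_(mdim M)) -> V.

(* The coordinate expression of [w] in the chart [c], as a family of
   functions (R^n)^p -> V indexed by u in [cmap c @` cdom c]. *)
Definition in_chart (R : realType) (M : manifold R) (V : vectType R) (p : nat)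
    (w : preform M V p) (c : chart R M (mdim M))
    (u : 'rV[R]_(mdim M)) (v : 'I_p -> 'rV[R]_(mdim M)) : V :=
  w (cinv c u) (fun i => 'd (cmap (chart_at (cinv c u)) \o cinv c) u (v i)).

Record is_form (R : realType) (M : manifold R) (V : vectType R) (p : nat)
    (w : preform M V p) : Prop := IsForm {
  form_multilinear : forall x (v : 'I_p -> tangent M) (i : 'I_p),
    linear (fun a : tangent M => w x [eta v with i |-> a]);
  form_alternating : forall x (v : 'I_p -> tangent M) (i j : 'I_p),
    i != j -> v i = v j -> w x v = 0;
  form_smooth : forall c (v : 'I_p -> tangent M), matlas c ->
    smooth_on (cmap c @` cdom c) (fun u => coords (in_chart w c u v)) }.

Definition pullback (R : realType) (M N : manifold R) (V : vectType R) (p : nat)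
    (f : M -> N) (w : preform N V p) : preform M V p :=
  fun x v => w (f x) (fun i => mdiff f x (v i)).

(* (dw)_x(v_0,...,v_p) = \sum_i (-1)^i D_(v_i) w(v_0,..,^v_i,..,v_p), computed in
   the chart [chart_at x], whose frame at x is the identity. *)
Definition dform (R : realType) (M : manifold R) (V : vectType R) (p : nat)
    (w : preform M V p) : preform M V p.+1 :=
  fun x v => \sum_(i < p.+1) (-1) ^+ i *:
    vderive (fun u => in_chart w (chart_at x) u (fun j => v (lift i j)))
            (cmap (chart_at x) x) (v i).

(* The wedge product combined with a bilinear map B, normalised so that for
   1-forms (a /\ b)(v, v') = B (a v) (b v') - B (a v') (b v). *)
Definition wedge (R : realType) (M : manifold R) (U V W : vectType R)
    (B : U -> V -> W) (p q : nat) (a : preform M U p) (b : preform M V q) :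
    preform M W (p + q) :=
  fun x v => ((p`! * q`!)%:R)^-1 *:
    \sum_(s : 'S_(p + q)) (-1) ^+ s *:
      B (a x (fun i => v (s (lshift q i)))) (b x (fun j => v (s (rshift p j)))).

Definition postcomp (R : realType) (M : manifold R) (V W : vectType R)
    (f : V -> W) (p : nat) (w : preform M V p) : preform M W p :=
  fun x v => f (w x v).

(* Transport along an equality of degrees. *)
Definition cast_form (R : realType) (M : manifold R) (V : vectType R)
    (p q : nat) (e : p = q) (w : preform M V p) : preform M V q :=
  fun x v => w x (fun i => v (cast_ord e i)).

Record lie_algebra (R : realType) := LieAlgebra {
  lie_carrier :> vectType R;
  bracket : lie_carrier -> lie_carrier -> lie_carrier;
  bracket_linearl : forall y, linear (bracket^~ y);
  bracket_linearr : forall x, linear (bracket x);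
  bracket_alt : forall x, bracket x x = 0;
  bracket_jacobi : forall x y z,
    bracket x (bracket y z) + bracket y (bracket z x) + bracket z (bracket x y)
      = 0 }.

Record lie2_algebra (R : realType) := Lie2Algebra {
  lie2_h : lie_algebra R;
  lie2_g : lie_algebra R;
  lie2_t : lie2_h -> lie2_g;
  lie2_a : lie2_g -> lie2_h -> lie2_h;
  lie2_t_linear : linear lie2_t;
  lie2_t_bracket : forall y y',
    lie2_t (bracket y y') = bracket (lie2_t y) (lie2_t y');
  lie2_a_linearl : forall y, linear (lie2_a^~ y);
  lie2_a_linearr : forall x, linear (lie2_a x);
  lie2_a_action : forall x x' y,
    lie2_a (bracket x x') y = lie2_a x (lie2_a x' y) - lie2_a x' (lie2_a x y);
  lie2_a_derivation : forall x y y',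
    lie2_a x (bracket y y') = bracket (lie2_a x y) y' + bracket y (lie2_a x y');
  lie2_peiffer : forall y y', lie2_a (lie2_t y) y' = bracket y y';
  lie2_equivariant : forall x y, lie2_t (lie2_a x y) = bracket x (lie2_t y) }.

(* Pairs (g, f) with s g = t f; the composite of such a pair is "g after f".
   It carries the subspace topology of the product (the library's topology on
   [set_type]). *)
Definition composable (M N : Type) (s t : M -> N) : set (M * M) :=
  [set gf | s gf.1 = t gf.2].

Definition cpair (M N : Type) (s t : M -> N) (g f : M) (e : s g = t f) :
    set_type (composable s t) :=
  exist _ (g, f) (mem_set (e : composable s t (g, f))).

(* [pairs] is the space of composable pairs as an embedded submanifold of
   Mor x Mor: its topology is the subspace topology, the projections are smooth
   and the tangent map of the inclusion is injective.  These conditions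
   determine its smooth structure, which exists because s and t are
   submersions. *)
Record lie_groupoid (R : realType) := LieGroupoid {
  Obj : manifold R;
  Mor : manifold R;
  src : Mor -> Obj;
  tgt : Mor -> Obj;
  src_submersion : submersion src;
  tgt_submersion : submersion tgt;
  pairs_dim : nat;
  pairs_struct : smooth_structure R (set_type (composable src tgt)) pairs_dim;
  pairs : manifold R := Manifold pairs_struct;
  pr1 : pairs -> Mor := fun gf => (set_val gf).1;
  pr2 : pairs -> Mor := fun gf => (set_val gf).2;
  pr1_smooth : smooth_map pr1;
  pr2_smooth : smooth_map pr2;
  pairs_immersed : forall (x : pairs) (v : tangent pairs),
    mdiff pr1 x v = 0 -> mdiff pr2 x v = 0 -> v = 0;
  gcomp : pairs -> Mor;
  gunit : Obj -> Mor;
  ginv : Mor -> Mor;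
  gcomp_smooth : smooth_map gcomp;
  gunit_smooth : smooth_map gunit;
  ginv_smooth : smooth_map ginv;
  src_comp : forall gf, src (gcomp gf) = src (pr2 gf);
  tgt_comp : forall gf, tgt (gcomp gf) = tgt (pr1 gf);
  src_unit : forall x, src (gunit x) = x;
  tgt_unit : forall x, tgt (gunit x) = x;
  src_inv : forall f, src (ginv f) = tgt f;
  tgt_inv : forall f, tgt (ginv f) = src f;
  gcomp_unitl : forall f (e : src (gunit (tgt f)) = tgt f), gcomp (cpair e) = f;
  gcomp_unitr : forall f (e : src f = tgt (gunit (src f))), gcomp (cpair e) = f;
  gcomp_invl : forall f (e : src (ginv f) = tgt f),
    gcomp (cpair e) = gunit (src f);
  gcomp_invr : forall f (e : src f = tgt (ginv f)),
    gcomp (cpair e) = gunit (tgt f);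
  gcomp_assoc : forall h g f (ehg : src h = tgt g) (egf : src g = tgt f)
    (el : src (gcomp (cpair ehg)) = tgt f)
    (er : src h = tgt (gcomp (cpair egf))),
    gcomp (cpair el) = gcomp (cpair er) }.

Definition Delta_obj (R : realType) (P : lie_groupoid R) (V : vectType R)
    (p : nat) (w : preform (Obj P) V p) : preform (Mor P) V p :=
  pullback (@tgt R P) w - pullback (@src R P) w.

Definition Delta_mor (R : realType) (P : lie_groupoid R) (V : vectType R)
    (p : nat) (w : preform (Mor P) V p) : preform (pairs P) V p :=
  pullback (@pr1 R P) w - pullback (@gcomp R P) w + pullback (@pr2 R P) w.

(* Triples (a, b, c); the elements of Omega^p(P, gamma) are those satisfying
   [in_Omega] below. *)
Definition gpreform (R : realType) (P : lie_groupoid R) (G : lie2_algebra R)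
    (p : nat) : Type :=
  (preform (Obj P) (lie2_g G) p * preform (Mor P) (lie2_h G) p
   * preform (Obj P) (lie2_h G) p.+1)%type.

Section GroupoidForms.
Context (R : realType) (P : lie_groupoid R) (G : lie2_algebra R).

Definition fa (p : nat) (Psi : gpreform P G p) :
  preform (Obj P) (lie2_g G) p := Psi.1.1.
Definition fb (p : nat) (Psi : gpreform P G p) :
  preform (Mor P) (lie2_h G) p := Psi.1.2.
Definition fc (p : nat) (Psi : gpreform P G p) :
  preform (Obj P) (lie2_h G) p.+1 := Psi.2.

Record in_Omega (p : nat) (Psi : gpreform P G p) : Prop := InOmega {
  Omega_a : is_form (fa Psi);
  Omega_b : is_form (fb Psi);
  Omega_c : is_form (fc Psi);
  Omega_Delta_a : Delta_obj (fa Psi) = postcomp (@lie2_t R G) (fb Psi);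
  Omega_Delta_b : Delta_mor (fb Psi) = 0 }.

Definition gD (p : nat) (Psi : gpreform P G p) : gpreform P G p.+1 :=
  (dform (fa Psi) - (-1) ^+ p *: postcomp (@lie2_t R G) (fc Psi),
   dform (fb Psi) - (-1) ^+ p *: Delta_obj (fc Psi),
   dform (fc Psi)).

Definition gwedge (k l : nat) (Psi : gpreform P G k) (Phi : gpreform P G l) :
    gpreform P G (k + l) :=
  let s := @src R P in
  let br := @bracket R (lie2_h G) in
  let al := @lie2_a R G in
  (wedge (@bracket R (lie2_g G)) (fa Psi) (fa Phi),
   wedge br (fb Psi) (fb Phi)
     + wedge al (pullback s (fa Psi)) (fb Phi)
     - (-1) ^+ (k * l) *:
         cast_form (addnC l k) (wedge al (pullback s (fa Phi)) (fb Psi)),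
   cast_form (addnS k l) (wedge al (fa Psi) (fc Phi))
     - (-1) ^+ (k * l) *:
         cast_form (etrans (addnS l k) (congr1 S (addnC l k)))
           (wedge al (fa Phi) (fc Psi))).

Definition gcast (p q : nat) (e : p = q) (Psi : gpreform P G p) :
    gpreform P G q :=
  (cast_form e (fa Psi), cast_form e (fb Psi), cast_form (congr1 S e) (fc Psi)).

End GroupoidForms.

Lemma add_rot1 (k l i : nat) : (i + k + l = k + l + i)%N.
Proof. by rewrite -addnA addnC. Qed.

Lemma add_rot2 (k l i : nat) : (l + i + k = k + l + i)%N.
Proof. by rewrite addnC addnA. Qed.

(* Main.v *)
(* All identities are checked at a point, where a wedge product is an alternating
   sum, over the permutations of the arguments, of a multilinear expression.
   Nested alternating sums collapse to a single one, so graded commutativity and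
   the Jacobi identity reduce to signs of block permutations and to the axioms of
   a Lie 2-algebra; on the components (s^* a, b) the product is the wedge bracket
   of the semidirect product of g and h.  Likewise p! dw is the alternation of
   v |-> D_(v 0) w (v 1, ..., v p): the Leibniz rule is then the product rule for
   directional derivatives, and d commutes with pullbacks because the additional
   term contains a second derivative, which is symmetric and therefore killed by
   the alternation.  Applied to changes of charts, this also gives smoothness of
   dw.  The conditions on Delta follow from t^* a = s^* a + t_* b and from the
   functoriality of pullback on composable pairs. *)
Require Import Defs.
From HB Require Import structures.
From mathcomp Require Import all_boot all_order all_fingroup all_algebra.
From mathcomp Require Import all_classical all_reals all_analysis.
From mathcomp Require Import zify ring lra.

Set Implicit Arguments.
Unset Strict Implicit.
Unset Printing Implicit Defensive.

Import Order.TTheory GRing.Theory Num.Theory.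
Import numFieldNormedType.Exports.

Local Open Scope classical_set_scope.
Local Open Scope ring_scope.

(** * Signs of permutations and alternating sums *)

(* Splits the innermost conditionals first, so that [lia] sees atomic tests. *)
Ltac case_ifs := repeat match goal with
  |- context [if ?b then _ else _] =>
    lazymatch b with
    | context [if _ then _ else _] => fail
    | _ => case: (boolP b) => ?
    end
  end.

(** The first obstacle is that a form of degree p takes arguments indexed by ['I_p], so that
    products ordered or nested differently live in different types. Forms are therefore evaluated on
    infinite sequences of vectors, of which only an initial segment matters ([dep]), and
    permutations act on all of nat, as the identity beyond their range. Transports along equalities
    of degrees then disappear, and block permutations become arithmetic on indices. Sums run over
    all permutations rather than over shuffles; in characteristic zero the factorials in front
    compensate for the repetitions. The second obstacle is that [dform] differentiates in a
    different chart at every point, so that no fixed chart sees it directly. Finally, the Leibniz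
    rule for the b-component does not follow from the product formulas alone: [gD] brings in the
    target pullback of the c-component of the product, and there the condition on Delta of the
    a-components and the Peiffer identity [lie2_peiffer] enter. *)

Definition pnat (N : nat) (s : 'S_N) (j : nat) : nat :=
  if insub j is Some i then s i : nat else j.

Lemma pnat_ord N (s : 'S_N) (i : 'I_N) : pnat s i = s i.
Proof. by rewrite /pnat valK. Qed.

Lemma pnat_out N (s : 'S_N) j : (N <= j)%N -> pnat s j = j.
Proof. by move=> Nj; rewrite /pnat insubN // -leqNgt. Qed.

Lemma pnat_lt N (s : 'S_N) j : (j < N)%N -> (pnat s j < N)%N.
Proof. by move=> jN; rewrite -[j]/(val (Ordinal jN)) pnat_ord ltn_ord. Qed.

Lemma pnatM N (s t : 'S_N) : pnat (s * t)%g = pnat t \o pnat s.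
Proof.
apply: funext => j /=; have [Nj|jN] := leqP N j; first by rewrite !pnat_out.
by rewrite -[j]/(val (Ordinal jN)) !pnat_ord permM.
Qed.

Lemma pnat1 N : pnat (1 : 'S_N)%g = id.
Proof.
apply: funext => j; have [Nj|jN] := leqP N j; first by rewrite pnat_out.
by rewrite -[j]/(val (Ordinal jN)) pnat_ord perm1.
Qed.

(** A relation rather than a sign function: index maps can be given by arithmetic on nat, and their
    parity is found by composition, without exhibiting the underlying permutation. *)
Definition sgn_on (N : nat) (f : nat -> nat) (b : bool) :=
  exists2 s : 'S_N, f = pnat s & odd_perm s = b.

Lemma sgn_id N : sgn_on N id false.
Proof. by exists 1%g; rewrite ?pnat1 ?odd_perm1. Qed.

Lemma sgn_comp N f g b c :
  sgn_on N f b -> sgn_on N g c -> sgn_on N (f \o g) (b (+) c).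
Proof.
move=> [s -> <-] [t -> <-]; exists (t * s)%g; first by rewrite pnatM.
by rewrite odd_permM addbC.
Qed.

Definition swapn (i j m : nat) : nat :=
  if m == i then j else if m == j then i else m.

Lemma pnat_tperm N (x y : 'I_N) : pnat (tperm x y) = swapn x y.
Proof.
apply: funext => m; rewrite /swapn; have [Nm|mN] := leqP N m.
  by rewrite pnat_out //; have := ltn_ord x; have := ltn_ord y;
    case_ifs; lia.
rewrite -[m]/(val (Ordinal mN)) pnat_ord permE /= -!val_eqE /=.
by case_ifs.
Qed.

Lemma sgn_swapn N i j : (i < N)%N -> (j < N)%N -> i != j ->
  sgn_on N (swapn i j) true.
Proof.
move=> iN jN ij; exists (tperm (Ordinal iN) (Ordinal jN)).
  by rewrite pnat_tperm.
by rewrite odd_tperm -val_eqE.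
Qed.

Definition blk (d m : nat) (f : nat -> nat) (j : nat) : nat :=
  if (d <= j < d + m)%N then (d + f (j - d))%N else j.

(** In a decomposition into transpositions, the shift by d turns each factor into the transposition
    of the shifted indices, so the parity is unchanged. *)
Lemma sgn_blk N d m (s : 'S_m) : (d + m <= N)%N ->
  sgn_on N (blk d m (pnat s)) (odd_perm s).
Proof.
move=> dmN; have [ts -> dts] := prod_tpermP s; elim: ts dts => [|t ts IH] /=.
  move=> _; rewrite !big_nil odd_perm1 pnat1.
  rewrite (_ : blk _ _ _ = id); first exact: sgn_id.
  by apply: funext => j; rewrite /blk; case: ifP => //; lia.
case/andP=> dt /IH {}IH; rewrite big_cons odd_permM addbC odd_tperm.
have -> : t.1 != t.2 = true by exact: dt.
rewrite (_ : blk _ _ _ = blk d m (pnat (\prod_(t <- ts) tperm t.1 t.2)) \o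
  swapn (d + t.1) (d + t.2)).
  apply: sgn_comp => //; apply: sgn_swapn.
  - by have := ltn_ord t.1; lia.
  - by have := ltn_ord t.2; lia.
  - by rewrite eqn_add2l val_eqE.
apply: funext => j; rewrite pnatM pnat_tperm /blk /swapn /=.
have := ltn_ord t.1; have := ltn_ord t.2 => t1 t2.
have [jt1|jt1] := eqVneq j (d + t.1)%N.
  by rewrite jt1 addKn !eqxx !leq_addr !ltn_add2l t1 t2 /= addKn.
have [jt2|jt2] := eqVneq j (d + t.2)%N.
  rewrite jt2 addKn !eqxx !leq_addr !ltn_add2l t1 t2 /= addKn.
  by case: ifP => // /eqP h; rewrite jt2 h eqxx in jt1.
case: ifP => // /andP[dj _]; case: ifP => [/eqP e|_].
  by rewrite -e subnKC // eqxx in jt1.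
case: ifP => [/eqP e|//].
by rewrite -e subnKC // eqxx in jt2.
Qed.

(** The exchange of two adjacent blocks, of lengths p and q, starting at d. *)
Definition rotn (d p q j : nat) : nat :=
  if (d <= j < d + p)%N then (j + q)%N
  else if (d + p <= j < d + p + q)%N then (j - p)%N else j.

(** One letter passes q others by q adjacent transpositions; a block of p letters passes them one
    letter at a time, its last letter first. *)
Lemma sgn_rotn N d p q : (d + p + q <= N)%N ->
  sgn_on N (rotn d p q) (odd (p * q)).
Proof.
have rot1 d' q' : (d' + 1 + q' <= N)%N -> sgn_on N (rotn d' 1 q') (odd q').
  elim: q' => [|r IH] rN.
    rewrite (_ : rotn _ _ _ = id); first exact: sgn_id.
    by apply: funext => j; rewrite /rotn; case_ifs; lia.
  rewrite /= -[~~ _]addTb.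
  rewrite (_ : rotn _ _ _ = swapn (d' + r) (d' + r.+1) \o rotn d' 1 r).
    by apply: sgn_comp; [apply: sgn_swapn|apply: IH]; lia.
  apply: funext => j; rewrite /rotn /swapn /=.
  case_ifs; lia.
elim: p => [|p IH] dN.
  rewrite (_ : rotn _ _ _ = id); first exact: sgn_id.
  by apply: funext => j; rewrite /rotn; case_ifs; lia.
rewrite mulSn oddD addbC.
rewrite (_ : rotn _ _ _ = rotn d p q \o rotn (d + p) 1 q).
  by apply: sgn_comp; [apply: IH|apply: rot1]; lia.
apply: funext => j; rewrite /rotn /=.
case_ifs; lia.
Qed.

Section LinearFacts.
Context (R : pzRingType) (U V : lmodType R) (f : U -> V).
Context (linf : linear f).

(** The axioms on brackets and actions state linearity as a proposition; packing it gives access to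
    the theory of linear maps. *)
Let g : {linear U -> V} := HB.pack f (GRing.isLinear.Build R U V _ f linf).

Lemma lin0 : f 0 = 0. Proof. exact: (linear0 g). Qed.
Lemma linN : {morph f : x / - x}. Proof. exact: (linearN g). Qed.
Lemma linD : {morph f : x y / x + y}. Proof. exact: (linearD g). Qed.
Lemma linB : {morph f : x y / x - y}. Proof. exact: (linearB g). Qed.
Lemma linZ k : {morph f : x / k *: x}. Proof. exact: (linearZ_LR g). Qed.
Lemma lin_sum (I : Type) (r : seq I) (P : pred I) (E : I -> U) :
  f (\sum_(i <- r | P i) E i) = \sum_(i <- r | P i) f (E i).
Proof. exact: (linear_sum g). Qed.

End LinearFacts.

Section Alternation.
Context (R : numFieldType) (T : Type).
Implicit Types (U V W X Y : lmodType R).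

Definition Alt W (N : nat) (F : (nat -> T) -> W) (v : nat -> T) : W :=
  \sum_(s : 'S_N) (-1) ^+ s *: F (v \o pnat s).

(** The permutation sits inside [F], so it is absorbed by a left translation of the summation
    variable. *)
Lemma Alt_sgn W N (F : (nat -> T) -> W) f b v : sgn_on N f b ->
  Alt N (fun w => F (w \o f)) v = (-1) ^+ b *: Alt N F v.
Proof.
case=> t -> <-; rewrite /Alt [in RHS](reindex_inj (mulgI t)) /= scaler_sumr.
apply: eq_bigr => s _; rewrite pnatM odd_permM scalerA; congr (_ *: _).
by rewrite signr_addb mulrA -signr_addb addbb mul1r.
Qed.

Lemma eq_Alt W N (F G : (nat -> T) -> W) v :
  (forall w, F w = G w) -> Alt N F v = Alt N G v.
Proof. by move=> FG; apply: eq_bigr => s _; rewrite FG. Qed.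

Lemma AltD W N (F G : (nat -> T) -> W) v :
  Alt N (fun w => F w + G w) v = Alt N F v + Alt N G v.
Proof. by rewrite -big_split; apply: eq_bigr => s _; rewrite scalerDr. Qed.

Lemma AltZ W N (F : (nat -> T) -> W) k v :
  Alt N (fun w => k *: F w) v = k *: Alt N F v.
Proof.
by rewrite scaler_sumr; apply: eq_bigr => s _; rewrite !scalerA mulrC.
Qed.

Lemma Alt_sum W N (I : finType) (F : I -> (nat -> T) -> W) v :
  Alt N (fun w => \sum_i F i w) v = \sum_i Alt N (F i) v.
Proof.
rewrite exchange_big; apply: eq_bigr => s _ /=; by rewrite scaler_sumr.
Qed.

(** Each inner permutation, extended to the window starting at d, is absorbed by the outer sum; its
    sign then occurs twice, so all m! terms agree. *)
Lemma Alt_absorb W N d m (K : (nat -> T) -> W) v : (d + m <= N)%N ->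
  Alt N (fun w => \sum_(s : 'S_m) (-1) ^+ s *: K (w \o blk d m (pnat s))) v
  = (m`!)%:R *: Alt N K v.
Proof.
move=> dmN; rewrite Alt_sum.
under eq_bigr => s _.
  rewrite AltZ (Alt_sgn _ _ (sgn_blk s dmN)) scalerA -signr_addb addbb scale1r.
  over.
by rewrite sumr_const cardT -cardE card_Sn scaler_nat.
Qed.

Definition dep W (p : nat) (F : (nat -> T) -> W) :=
  forall v w, (forall j, (j < p)%N -> v j = w j) -> F v = F w.

Lemma dep_Alt W N (F : (nat -> T) -> W) : dep N F -> dep N (Alt N F).
Proof.
move=> dF v w vw; apply: eq_bigr => s _; congr (_ *: _); apply: dF => j jN /=.
by apply: vw; apply: pnat_lt.
Qed.

End Alternation.

(** * Wedge products of functions of sequences *)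

HB.lock Definition nwedge (R : numFieldType) (T : Type) (U V W : lmodType R)
    (B : U -> V -> W) (p q : nat)
    (a : (nat -> T) -> U) (b : (nat -> T) -> V) (v : nat -> T) : W :=
  ((p`! * q`!)%:R)^-1 *: Alt (p + q) (fun w => B (a w) (b (w \o addn p))) v.

(** The common normal form of the two nestings of a triple product; the trilinear map remembers how
    the factors were nested. *)
HB.lock Definition nwedge3 (R : numFieldType) (T : Type)
    (U V W X : lmodType R) (B : U -> V -> W -> X) (p q r : nat)
    (a : (nat -> T) -> U) (b : (nat -> T) -> V) (c : (nat -> T) -> W)
    (v : nat -> T) : X :=
  ((p`! * q`! * r`!)%:R)^-1 *:
  Alt (p + q + r)
    (fun w => B (a w) (b (w \o addn p)) (c (w \o addn (p + q)))) v.

Section Wedge.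
Context (R : numFieldType) (T : Type).
Implicit Types (U V W X Y : lmodType R).

Lemma dep_nwedge U V W (B : U -> V -> W) p q (a : (nat -> T) -> U)
    (b : (nat -> T) -> V) :
  dep p a -> dep q b -> dep (p + q) (nwedge B p q a b).
Proof.
move=> da db v w vw; rewrite nwedge.unlock; congr (_ *: _).
apply: dep_Alt => // {vw}v {}w vw.
congr B; [apply: da|apply: db] => j jp; apply: vw => //=; lia.
Qed.

Lemma nwedge_comm U V W (B : U -> V -> W) p q (a : (nat -> T) -> U)
    (b : (nat -> T) -> V) v : dep p a -> dep q b ->
  nwedge (fun y x => B x y) q p b a v = (-1) ^+ (p * q) *: nwedge B p q a b v.
Proof.
move=> da db; rewrite nwedge.unlock scalerA mulrC -scalerA mulnC addnC.
congr (_ *: _).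
have h : (0 + p + q <= p + q)%N by [].
rewrite -signr_odd -(Alt_sgn _ _ (sgn_rotn h)); apply: eq_Alt => w.
congr B; [apply: da|apply: db] => j jp /=; congr (w _); rewrite /rotn /=;
  case_ifs; lia.
Qed.

Lemma nwedge3_swap12 U V W X (B : U -> V -> W -> X) p q r (a : (nat -> T) -> U)
    (b : (nat -> T) -> V) (c : (nat -> T) -> W) v :
  dep p a -> dep q b -> dep r c ->
  nwedge3 (fun y x z => B x y z) q p r b a c v
  = (-1) ^+ (p * q) *: nwedge3 B p q r a b c v.
Proof.
move=> da db dc; rewrite nwedge3.unlock scalerA mulrC -scalerA.
rewrite [(q`! * p`!)%N]mulnC [(q + p)%N]addnC; congr (_ *: _).
have h : (0 + p + q <= p + q + r)%N by lia.
rewrite -signr_odd -(Alt_sgn _ _ (sgn_rotn h)); apply: eq_Alt => w.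
congr B; [apply: da|apply: db|apply: dc] => j jp /=; congr (w _);
  rewrite /rotn /=; case_ifs; lia.
Qed.

Lemma nwedge3_swap23 U V W X (B : U -> V -> W -> X) p q r (a : (nat -> T) -> U)
    (b : (nat -> T) -> V) (c : (nat -> T) -> W) v :
  dep p a -> dep q b -> dep r c ->
  nwedge3 (fun x z y => B x y z) p r q a c b v
  = (-1) ^+ (q * r) *: nwedge3 B p q r a b c v.
Proof.
move=> da db dc; rewrite nwedge3.unlock scalerA mulrC -scalerA.
rewrite [(p`! * r`! * _)%N]mulnAC [(p + r + q)%N]addnAC; congr (_ *: _).
have h : (p + q + r <= p + q + r)%N by lia.
rewrite -signr_odd -(Alt_sgn _ _ (sgn_rotn h)); apply: eq_Alt => w.
congr B; [apply: da|apply: db|apply: dc] => j jp /=; congr (w _);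
  rewrite /rotn /=; case_ifs; lia.
Qed.

Let char0 n : (n`!)%:R != 0 :> R.
Proof. by rewrite pnatr_eq0 -lt0n fact_gt0. Qed.

(** The inner alternation runs over the first p + q arguments and is absorbed with multiplicity (p +
    q)!, which cancels the same factorial in the outer normalisation. *)
Lemma nwedgeA_left U V W X Y (B : X -> W -> Y) (C : U -> V -> X) p q r
    (a : (nat -> T) -> U) (b : (nat -> T) -> V) (c : (nat -> T) -> W) v :
  (forall y, linear (B^~ y)) -> dep p a -> dep q b -> dep r c ->
  nwedge B (p + q) r (nwedge C p q a b) c v
  = nwedge3 (fun x y z => B (C x y) z) p q r a b c v.
Proof.
move=> lB da db dc; rewrite nwedge.unlock nwedge3.unlock.
pose K w := B (C (a w) (b (w \o addn p))) (c (w \o addn (p + q))).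
under eq_Alt => w.
  rewrite (linZ (lB _)) (lin_sum (lB _)).
  under eq_bigr => s _.
    rewrite (linZ (lB _)).
    rewrite (_ : B _ _ = K (w \o blk 0 (p + q) (pnat s))); last first.
      rewrite /K; congr (B (C _ _)); [apply: da|apply: db|apply: dc];
        move=> j jp /=; congr (w _); rewrite /blk /=.
      - by case: ifP; rewrite ?subn0 //; lia.
      - by case: ifP; rewrite ?subn0 //; lia.
      - by case: ifP; rewrite ?subn0 //; lia.
    over.
  over.
rewrite AltZ Alt_absorb ?leq_addr // !scalerA; congr (_ *: _).
rewrite !natrM; have := char0 p; have := char0 q; have := char0 r.
have := char0 (p + q)%N.
set P := (p`!)%:R; set Q := (q`!)%:R; set S := (r`!)%:R; set Z := ((p + q)`!)%:R.
by move=> hZ hS hQ hP; field; rewrite hZ hS hQ hP.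
Qed.

Lemma nwedgeA_right U V W X Y (B : U -> X -> Y) (C : V -> W -> X) p q r
    (a : (nat -> T) -> U) (b : (nat -> T) -> V) (c : (nat -> T) -> W) v :
  (forall x, linear (B x)) -> dep p a -> dep q b -> dep r c ->
  nwedge B p (q + r) a (nwedge C q r b c) v
  = nwedge3 (fun x y z => B x (C y z)) p q r a b c v.
Proof.
move=> lB da db dc; rewrite nwedge.unlock nwedge3.unlock addnA.
pose K w := B (a w) (C (b (w \o addn p)) (c (w \o addn (p + q)))).
under eq_Alt => w.
  rewrite (linZ (lB _)) (lin_sum (lB _)).
  under eq_bigr => s _.
    rewrite (linZ (lB _)).
    rewrite (_ : B _ _ = K (w \o blk p (q + r) (pnat s))); last first.
      rewrite /K; congr (B _ (C _ _)); [apply: da|apply: db|apply: dc];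
        move=> j jp /=; congr (w _); rewrite /blk /=.
      - by case: ifP; lia.
      - by rewrite ifT ?addKn //; lia.
      - by rewrite ifT -?addnA ?addKn //; lia.
    over.
  over.
rewrite AltZ Alt_absorb ?addnA // !scalerA; congr (_ *: _).
rewrite !natrM; have := char0 p; have := char0 q; have := char0 r.
have := char0 (q + r)%N.
set P := (p`!)%:R; set Q := (q`!)%:R; set S := (r`!)%:R; set Z := ((q + r)`!)%:R.
by move=> hZ hS hQ hP; field; rewrite hZ hS hQ hP.
Qed.

End Wedge.

(** * Multilinear algebra of the wedge product *)

Section WedgeAlgebra.
Context (R : numFieldType) (T : Type).
Implicit Types (U V W X Y : lmodType R).

Lemma eq_nwedge U V W (B B' : U -> V -> W) p q
    (a a' : (nat -> T) -> U) (b b' : (nat -> T) -> V) v :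
  (forall x y, B x y = B' x y) -> (forall w, a w = a' w) ->
  (forall w, b w = b' w) -> nwedge B p q a b v = nwedge B' p q a' b' v.
Proof.
rewrite nwedge.unlock => BB aa bb; congr (_ *: _); apply: eq_Alt => w.
by rewrite BB aa bb.
Qed.

Lemma nwedge_lin U V W Y (f : W -> Y) (B : U -> V -> W) p q
    (a : (nat -> T) -> U) (b : (nat -> T) -> V) v :
  linear f ->
  f (nwedge B p q a b v) = nwedge (fun x y => f (B x y)) p q a b v.
Proof.
move=> lf; rewrite nwedge.unlock (linZ lf) (lin_sum lf); congr (_ *: _).
by apply: eq_bigr => s _; rewrite (linZ lf).
Qed.

Lemma nwedge_addf U V W (B B' : U -> V -> W) p q
    (a : (nat -> T) -> U) (b : (nat -> T) -> V) v :
  nwedge (fun x y => B x y + B' x y) p q a b v =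
  nwedge B p q a b v + nwedge B' p q a b v.
Proof. by rewrite nwedge.unlock AltD scalerDr. Qed.

Lemma nwedge_oppf U V W (B : U -> V -> W) p q
    (a : (nat -> T) -> U) (b : (nat -> T) -> V) v :
  nwedge (fun x y => - B x y) p q a b v = - nwedge B p q a b v.
Proof.
rewrite nwedge.unlock -scaleN1r scalerA mulrC -scalerA; congr (_ *: _).
by rewrite -AltZ; apply: eq_Alt => w; rewrite scaleN1r.
Qed.

Section Left.
Context U V W (B : U -> V -> W) (p q : nat) (b : (nat -> T) -> V).
Context (lB : forall y, linear (B^~ y)).
Lemma nwedgeDl a a' v : nwedge B p q (fun w => a w + a' w) b v =
  nwedge B p q a b v + nwedge B p q a' b v.
Proof.
by rewrite nwedge.unlock -scalerDr -AltD; congr (_ *: _); apply: eq_Alt => w;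
  rewrite (linD (lB _)).
Qed.
Lemma nwedgeZl k a v : nwedge B p q (fun w => k *: a w) b v =
  k *: nwedge B p q a b v.
Proof.
rewrite nwedge.unlock scalerA mulrC -scalerA -AltZ; congr (_ *: _).
by apply: eq_Alt => w; rewrite (linZ (lB _)).
Qed.
Lemma nwedgeBl a a' v : nwedge B p q (fun w => a w - a' w) b v =
  nwedge B p q a b v - nwedge B p q a' b v.
Proof.
rewrite -scaleN1r -nwedgeZl -nwedgeDl; apply: eq_nwedge => // w.
by rewrite scaleN1r.
Qed.
End Left.

Section Right.
Context U V W (B : U -> V -> W) (p q : nat) (a : (nat -> T) -> U).
Context (lB : forall x, linear (B x)).
Lemma nwedgeDr b b' v : nwedge B p q a (fun w => b w + b' w) v =
  nwedge B p q a b v + nwedge B p q a b' v.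
Proof.
by rewrite nwedge.unlock -scalerDr -AltD; congr (_ *: _); apply: eq_Alt => w;
  rewrite (linD (lB _)).
Qed.
Lemma nwedgeZr k b v : nwedge B p q a (fun w => k *: b w) v =
  k *: nwedge B p q a b v.
Proof.
rewrite nwedge.unlock scalerA mulrC -scalerA -AltZ; congr (_ *: _).
by apply: eq_Alt => w; rewrite (linZ (lB _)).
Qed.
Lemma nwedgeBr b b' v : nwedge B p q a (fun w => b w - b' w) v =
  nwedge B p q a b v - nwedge B p q a b' v.
Proof.
rewrite -scaleN1r -nwedgeZr -nwedgeDr; apply: eq_nwedge => // w.
by rewrite scaleN1r.
Qed.
End Right.

Lemma eq_nwedge3 U V W X (B B' : U -> V -> W -> X) p q r
    (a : (nat -> T) -> U) (b : (nat -> T) -> V) (c : (nat -> T) -> W) v :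
  (forall x y z, B x y z = B' x y z) ->
  nwedge3 B p q r a b c v = nwedge3 B' p q r a b c v.
Proof.
by rewrite nwedge3.unlock => BB; congr (_ *: _); apply: eq_Alt => w; rewrite BB.
Qed.

Lemma nwedge3D U V W X (B B' : U -> V -> W -> X) p q r
    (a : (nat -> T) -> U) (b : (nat -> T) -> V) (c : (nat -> T) -> W) v :
  nwedge3 B p q r a b c v + nwedge3 B' p q r a b c v =
  nwedge3 (fun x y z => B x y z + B' x y z) p q r a b c v.
Proof. by rewrite nwedge3.unlock -scalerDr -AltD. Qed.

Lemma nwedge3_0 U V W X p q r
    (a : (nat -> T) -> U) (b : (nat -> T) -> V) (c : (nat -> T) -> W) v :
  nwedge3 (fun _ _ _ => 0 : X) p q r a b c v = 0.
Proof.
by rewrite nwedge3.unlock /Alt big1 ?scaler0 // => s _; rewrite scaler0.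
Qed.

Lemma nwedge3_rot U V W X (B : W -> U -> V -> X) p q r a b c v :
  dep p a -> dep q b -> dep r c ->
  @nwedge3 _ T _ _ _ _ B r p q c a b v
  = (-1) ^+ (r * (p + q)) *: nwedge3 (fun x y z => B z x y) p q r a b c v.
Proof.
move=> da db dc.
rewrite (@nwedge3_swap12 _ _ _ _ _ _ (fun x z y => B z x y) p r q a c b) //.
rewrite (@nwedge3_swap23 _ _ _ _ _ _ (fun x y z => B z x y) p q r a b c) //.
by rewrite scalerA -exprD mulnDr [(q * r)%N]mulnC [(p * r)%N]mulnC.
Qed.

(** Once the factors are rotated to the order a, b, c, the signs of the rotations give all three
    prefactors the parity of k i, and the Jacobi identity applies under a single alternation. *)
Lemma nwedge_jacobi (L : lmodType R) (br : L -> L -> L) k l i a b c v :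
  (forall y, linear (br^~ y)) ->
  (forall x y z, br (br x y) z + br (br z x) y + br (br y z) x = 0) ->
  dep k a -> dep l b -> dep i c ->
  (-1) ^+ (k * i) *: nwedge br (k + l) i (nwedge br k l a b) c v
  + (-1) ^+ (l * i) *: nwedge br (i + k) l (nwedge br i k c a) b v
  + (-1) ^+ (k * l) *: @nwedge _ T _ _ _ br (l + i) k (nwedge br l i b c) a v = 0.
Proof.
move=> lbr jac da db dc; rewrite !nwedgeA_left //.
rewrite [X in _ + _ *: X + _]nwedge3_rot // [X in _ + _ + _ *: X]nwedge3_rot //.
rewrite [X in _ + _ + _ *: (_ *: X)]nwedge3_rot //.
rewrite !scalerA -!exprD.
rewrite -[(-1) ^+ (l * i + _)]signr_odd -[(-1) ^+ (k * l + _ + _)]signr_odd.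
rewrite (_ : odd (l * i + _) = odd (k * i)); last first.
  by rewrite !(oddD, oddM); do 3 case: odd.
rewrite (_ : odd (k * l + _ + _) = odd (k * i)); last first.
  by rewrite !(oddD, oddM); do 3 case: odd.
rewrite signr_odd -!scalerDr !nwedge3D.
rewrite (eq_nwedge3 _ _ _ _ _ _ _ (B' := fun _ _ _ => 0)) ?nwedge3_0 ?scaler0 //.
Qed.

(** In the last term the factors a and b have changed places; restoring their order cancels its sign
    and leaves the action axiom under one alternation. *)
Lemma nwedge_action (g h : lmodType R) (br : g -> g -> g) (al : g -> h -> h)
    k l m a b c v :
  (forall y, linear (al^~ y)) -> (forall x, linear (al x)) ->
  (forall x x' y, al (br x x') y = al x (al x' y) - al x' (al x y)) ->
  dep k a -> dep l b -> dep m c ->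
  @nwedge _ T _ _ _ al (k + l) m (nwedge br k l a b) c v
  = nwedge al k (l + m) a (nwedge al l m b c) v
    - (-1) ^+ (k * l) *: nwedge al l (k + m) b (nwedge al k m a c) v.
Proof.
move=> lal ral act da db dc; rewrite nwedgeA_left // !nwedgeA_right //.
rewrite [X in _ - _ *: X](nwedge3_swap12 (fun x y z => al y (al x z))) //.
rewrite scalerA -expr2 sqrr_sign scale1r.
apply/eqP; rewrite eq_sym subr_eq; apply/eqP; rewrite nwedge3D.
by apply: eq_nwedge3 => x y z; rewrite act subrK.
Qed.

(* The exterior derivative at a point of a [p]-form whose derivative in the
   direction [h] is [Da h]. *)
Definition nD U (p : nat) (Da : T -> (nat -> T) -> U) (v : nat -> T) : U :=
  (p`!)%:R^-1 *: Alt p.+1 (fun w => Da (w 0%N) (w \o succn)) v.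

(** The direction of differentiation is argument 0. When a is differentiated it already stands in
    front of the arguments of a; when b is, it has to pass the p arguments of a, which produces the
    sign (-1)^p. *)
Lemma nD_wedge U V W (B : U -> V -> W) p q (a : (nat -> T) -> U)
    (b : (nat -> T) -> V) (Da : T -> (nat -> T) -> U)
    (Db : T -> (nat -> T) -> V) v :
  (forall y, linear (B^~ y)) -> (forall x, linear (B x)) ->
  dep p a -> dep q b -> (forall h, dep p (Da h)) -> (forall h, dep q (Db h)) ->
  nD (p + q) (fun h w => nwedge B p q (Da h) b w + nwedge B p q a (Db h) w) v
  = nwedge B p.+1 q (nD p Da) b v
    + (-1) ^+ p *: nwedge B p q.+1 a (nD q Db) v.
Proof.
move=> lBl lBr da db dDa dDb; rewrite nwedge.unlock /nD.
have char0 n : (n`!)%:R != 0 :> R by rewrite pnatr_eq0 -lt0n fact_gt0.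
have dDb' h h' x y : h = h' -> (forall j, (j < q)%N -> x j = y j) ->
  Db h x = Db h' y by move=> -> /dDb.
pose Kl w := B (Da (w 0%N) (w \o succn)) (b (w \o addn p.+1)).
pose Kr w := B (a (w \o succn)) (Db (w 0%N) (w \o addn p.+1)).
(* This is [Kr] with the direction placed just before the arguments of b, as the right-hand side
   expects it. *)
pose Kr' w := B (a w) (Db (w p) (w \o addn p.+1)).
transitivity ((p`! * q`!)%:R^-1 *:
    (Alt (p + q).+1 Kl v + Alt (p + q).+1 Kr v)).
  rewrite -AltD.
  under eq_Alt => w.
    rewrite -scalerDr /Alt -big_split /=.
    under eq_bigr => s _.
      rewrite -scalerDr.
      rewrite (_ : B _ _ + B _ _ = Kl (w \o blk 1 (p + q) (pnat s)) +
                                   Kr (w \o blk 1 (p + q) (pnat s))); last first.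
        rewrite /Kl /Kr; congr (B _ _ + B _ _);
          [apply: dDa|apply: db|apply: da|apply: dDb] => j jp /=; congr (w _);
          rewrite /blk /= ifT ?addSn ?subn1 //; lia.
      over.
    over.
  rewrite AltZ (Alt_absorb (fun w => Kl w + Kr w)) ?add1n // !scalerA.
  congr (_ *: _); rewrite natrM.
  have := char0 p; have := char0 q; have := char0 (p + q)%N.
  set P := (p`!)%:R; set Q := (q`!)%:R; set S := ((p + q)`!)%:R => hS hQ hP.
  by field; rewrite ?hS ?hQ ?hP.
rewrite scalerDr; congr (_ + _).
  rewrite addSn.
  under [in RHS]eq_Alt => w.
    rewrite (linZ (lBl _)) (lin_sum (lBl _)).
    under eq_bigr => s _.
      rewrite (linZ (lBl _)).
      rewrite (_ : B _ _ = Kl (w \o blk 0 p.+1 (pnat s))); last first.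
        rewrite /Kl; congr (B _ _).
        - apply: dDa => j jp /=; congr (w _); rewrite /blk /= ifT ?subn0 //; lia.
        - apply: db => j jp /=; congr (w _); rewrite /blk /= ifF; lia.
      over.
    over.
  rewrite AltZ Alt_absorb ?add0n ?leq_addr // !scalerA.
  congr (_ *: _); rewrite !natrM.
  have := char0 p; have := char0 q.
  have : 1 + p%:R != 0 :> R by rewrite addrC natr1 pnatr_eq0.
  set P := (p`!)%:R; set Q := (q`!)%:R => hS hQ hP.
  by field; rewrite ?hS ?hQ ?hP.
have h : (0 + p + 1 <= (p + q).+1)%N by lia.
have -> : Alt (p + q).+1 Kr v = (-1) ^+ p *: Alt (p + q).+1 Kr' v.
  rewrite -signr_odd -[p in odd p]muln1 -(Alt_sgn _ _ (sgn_rotn h)).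
  apply: eq_Alt => w; rewrite /Kr /Kr'; congr (B _ _).
  - by apply: da => j jp /=; congr (w _); rewrite /rotn /= ifT; lia.
  apply: dDb' => [|j jp] /=.
  - by rewrite /rotn /=; congr (w _); case_ifs; lia.
  - by congr (w _); rewrite /rotn /=; case_ifs; lia.
rewrite scalerA mulrC -scalerA; congr (_ *: _).
rewrite addnS.
under [in RHS]eq_Alt => w.
  rewrite (linZ (lBr _)) (lin_sum (lBr _)).
  under eq_bigr => s _.
    rewrite (linZ (lBr _)).
    rewrite (_ : B _ _ = Kr' (w \o blk p q.+1 (pnat s))); last first.
      rewrite /Kr'; congr (B _ _).
      - by apply: da => j jp /=; congr (w _); rewrite /blk /= ifF; lia.
      apply: dDb' => [|j jp] /=.
      - by congr (w _); rewrite /blk /= ifT ?subnn ?addn0 //; lia.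
      - congr (w _); rewrite /blk /= ifT; last by lia.
        by congr (_ + pnat _ _)%N; lia.
    over.
  over.
rewrite AltZ Alt_absorb ?addnS // !scalerA.
congr (_ *: _); rewrite !natrM.
have := char0 p; have := char0 q.
have : 1 + q%:R != 0 :> R by rewrite addrC natr1 pnatr_eq0.
set P := (p`!)%:R; set Q := (q`!)%:R => hS hQ hP.
by field; rewrite ?hS ?hQ ?hP.
Qed.

End WedgeAlgebra.

(** * Alternating multilinear maps *)

Section AlternatingMaps.
Context (R : numFieldType) (T : lmodType R).
Implicit Types (U V W X Y : lmodType R).

Definition upd (v : nat -> T) (i : nat) (a : T) (j : nat) : T :=
  if j == i then a else v j.

Definition mlin W (p : nat) (F : (nat -> T) -> W) :=
  forall v i, (i < p)%N -> linear (fun a => F (upd v i a)).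

Definition alternating W (p : nat) (F : (nat -> T) -> W) :=
  forall v i j, (i < p)%N -> (j < p)%N -> i != j -> v i = v j -> F v = 0.

Lemma eq_self_opp W (x : W) : x = - x -> x = 0.
Proof.
move=> /eqP; rewrite -subr_eq0 opprK -mulr2n -scaler_nat scaler_eq0.
by rewrite pnatr_eq0 => /eqP.
Qed.

Lemma linear_sumf W (I : finType) (F : I -> T -> W) :
  (forall i, linear (F i)) -> linear (fun a => \sum_i F i a).
Proof.
move=> lF k a b; rewrite scaler_sumr -big_split.
by apply: eq_bigr => i _; rewrite lF.
Qed.

Lemma linear_scalef W (F : T -> W) k : linear F -> linear (fun a => k *: F a).
Proof. by move=> lF c a b; rewrite lF scalerDr !scalerA mulrC. Qed.

Lemma upd_pnat N (s : 'S_N) (v : nat -> T) (i : 'I_N) (a : T) :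
  upd v i a \o pnat s = upd (v \o pnat s) ((s^-1)%g i) a.
Proof.
apply: funext => j; rewrite /upd /=; have [Nj|jN] := leqP N j.
  rewrite pnat_out //; case: ifP => [/eqP ji|_]; first by have := ltn_ord i; lia.
  by case: ifP => [/eqP ji|//]; have := ltn_ord ((s^-1)%g i); lia.
rewrite -[j]/(val (Ordinal jN)) pnat_ord !val_eqE.
by rewrite -(inj_eq (@perm_inj _ s^-1)%g) permK.
Qed.

Lemma mlin_Alt W N (F : (nat -> T) -> W) : mlin N F -> mlin N (Alt N F).
Proof.
move=> lF v i iN; apply: linear_sumf => s; apply: linear_scalef.
rewrite -[i]/(val (Ordinal iN)) => k a b; rewrite !upd_pnat.
exact: lF.
Qed.

(** Unlike in [Alt_sgn], the permutation acts on the arguments from outside, so the translation of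
    the summation variable is on the right. *)
Lemma Alt_pre W N (F : (nat -> T) -> W) f b v : sgn_on N f b ->
  Alt N F (v \o f) = (-1) ^+ b *: Alt N F v.
Proof.
case=> t -> <-; rewrite /Alt [in RHS](reindex_inj (mulIg t)) /= scaler_sumr.
apply: eq_bigr => s _; rewrite pnatM odd_permM scalerA; congr (_ *: _).
by rewrite addbC signr_addb mulrA -signr_addb addbb mul1r.
Qed.

(** Exchanging the two equal entries fixes the arguments but reverses the sign, so the value is its
    own opposite. *)
Lemma alternating_Alt W N (F : (nat -> T) -> W) : alternating N (Alt N F).
Proof.
move=> v i j iN jN ij vij; apply: eq_self_opp.
rewrite -scaleN1r -[-1]expr1 -(Alt_pre F v (sgn_swapn iN jN ij)).
congr (Alt _ _ _); apply: funext => m; rewrite /swapn /=.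
by case: ifP => [/eqP ->|_] //; case: ifP => [/eqP ->|].
Qed.

Lemma mlinZ W p (F : (nat -> T) -> W) k :
  mlin p F -> mlin p (fun v => k *: F v).
Proof. by move=> lF v i ip; apply: linear_scalef; apply: lF. Qed.

Lemma mlin_wedge U V W (B : U -> V -> W) p q a b :
  (forall y, linear (B^~ y)) -> (forall x, linear (B x)) ->
  dep p a -> dep q b -> mlin p a -> mlin q b ->
  mlin (p + q) (nwedge B p q a b).
Proof.
move=> lBl lBr da db la lb; rewrite nwedge.unlock.
apply: mlinZ; apply: mlin_Alt => v i ipq k x y.
have [ip|pi] := ltnP i p.
  have e z : b (upd v i z \o addn p) = b (v \o addn p).
    by apply: db => j jq; rewrite /upd /= ifF //; lia.
  by rewrite !e la // lBl.
have e z : a (upd v i z) = a v.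
  by apply: da => j jq; rewrite /upd /= ifF //; lia.
have e' z : upd v i z \o addn p = upd (v \o addn p) (i - p) z.
  by apply: funext => j; rewrite /upd /=; case_ifs => //; lia.
by rewrite !e !e' lb ?lBr //; lia.
Qed.

Lemma alternating_wedge U V W (B : U -> V -> W) p q a b :
  alternating (p + q) (nwedge B p q a b).
Proof.
rewrite nwedge.unlock => v i j ip jp ij vij.
by rewrite (alternating_Alt _ ip jp ij vij) scaler0.
Qed.

Lemma alternating_nD U p Da : alternating p.+1 (@nD _ _ U p Da).
Proof.
move=> v i j ip jp ij vij.
by rewrite /nD (alternating_Alt _ ip jp ij vij) scaler0.
Qed.

Lemma mlin_nD U p (Da : T -> (nat -> T) -> U) :
  (forall v, linear (Da^~ v)) -> (forall h, mlin p (Da h)) ->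
  mlin p.+1 (nD p Da).
Proof.
move=> l1 l2; apply: mlinZ; apply: mlin_Alt => v [|i] ip k x y.
  exact: (l1 (v \o succn) k x y).
have e z : upd v i.+1 z \o succn = upd (v \o succn) i z by apply: funext => j.
by rewrite !e; exact: (l2 (v 0%N) (v \o succn) i ip k x y).
Qed.

Lemma upd_swap (v : nat -> T) i j a b : i != j ->
  upd (upd v i a) j b = upd (upd v j b) i a.
Proof.
by move=> ij; apply: funext => m; rewrite /upd; case_ifs => //; lia.
Qed.

Lemma upd_id (v : nat -> T) i : upd v i (v i) = v.
Proof. by apply: funext => m; rewrite /upd; case: ifP => // /eqP ->. Qed.

Lemma upd_upd (v : nat -> T) i a b : upd (upd v i a) i b = upd v i b.
Proof. by apply: funext => m; rewrite /upd; case_ifs. Qed.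

Lemma alternating_swap W p (F : (nat -> T) -> W) v i j :
  mlin p F -> alternating p F -> (i < p)%N -> (j < p)%N -> i != j ->
  F (v \o swapn i j) = - F v.
Proof.
move=> lF aF ip jp ij; apply/eqP; rewrite -addr_eq0; apply/eqP.
pose G a b := F (upd (upd v i a) j b).
have l1 b : linear (G^~ b).
  by move=> k x y; rewrite /G !(upd_swap _ _ _ ij) lF.
have l2 a : linear (G a) by move=> k x y; rewrite /G lF.
have G0 a : G a a = 0.
  by apply: (aF _ i j) => //; rewrite /upd (negbTE ij) !eqxx.
(* Polarisation: putting the sum of both entries in both places leaves only the two mixed terms. *)
have := G0 (v i + v j); rewrite (linD (l1 _)) !(linD (l2 _)) !G0 add0r addr0.
rewrite addrC => <-; congr (_ + _).
  rewrite /G; congr F; apply: funext => m; rewrite /upd /swapn /=.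
  by case_ifs => //; congr v; lia.
by rewrite /G !upd_id.
Qed.

Lemma alternating_perm W p (F : (nat -> T) -> W) (s : 'S_p) v :
  mlin p F -> alternating p F -> F (v \o pnat s) = (-1) ^+ s *: F v.
Proof.
move=> lF aF; have [ts -> dts] := prod_tpermP s.
elim: ts dts v => [|t ts IH] /=.
  by move=> _ v; rewrite big_nil odd_perm1 pnat1 scale1r.
case/andP=> dt /IH {}IH v; rewrite big_cons pnatM odd_permM odd_tperm.
have -> : t.1 != t.2 = true by exact: dt.
rewrite compA pnat_tperm (alternating_swap _ lF aF) // IH -scaleN1r scalerA.
by rewrite signr_addb expr1.
Qed.

(** A permutation of p + 1 letters is the image i of 0 together with a permutation of the other p
    letters. As [Da h] is alternating, the p! permutations sharing the same i contribute equally,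
    which cancels the normalisation. *)
Lemma nD_head U p (Da : T -> (nat -> T) -> U) v :
  (forall h, mlin p (Da h)) -> (forall h, alternating p (Da h)) ->
  nD p Da v = \sum_(i < p.+1)
     (-1) ^+ i *: Da (v i) (fun j => v (if (j < i)%N then j else j.+1)).
Proof.
move=> lD aD; rewrite /nD /Alt.
have char0 n : (n`!)%:R != 0 :> R by rewrite pnatr_eq0 -lt0n fact_gt0.
apply: (scalerI (char0 p)); rewrite scalerA mulfV // scale1r scaler_sumr.
pose f (it : 'I_p.+1 * 'S_p) := lift_perm ord0 it.1 it.2.
have f_inj : injective f.
  case=> [i s] [j t] /permP e; have ij : i = j.
    by have := e ord0; rewrite !lift_perm_id.
  congr pair => //; apply/permP => k; apply: (@lift_inj _ j).
  by have := e (lift ord0 k); rewrite !lift_perm_lift ij.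
rewrite (reindex f); last first.
  apply: onW_bij; apply: (inj_card_bij f_inj).
  by rewrite card_prod !card_Sn card_ord factS.
pose G (s : 'S_p.+1) :=
  (-1) ^+ s *: Da ((v \o pnat s) 0%N) ((v \o pnat s) \o succn).
rewrite -(pair_bigA _ (fun i s => G (lift_perm ord0 i s))) /=; apply: eq_bigr => i _.
under eq_bigr => s _.
  rewrite /G odd_lift_perm /= signr_addb -scalerA.
  rewrite (_ : Da _ _ = Da (v i) ((fun j => v (if (j < i)%N then j else j.+1))
    \o pnat s)); last first.
    have -> : pnat (lift_perm ord0 i s) 0 = i.
      by rewrite -[0%N]/(val (@ord0 p)) pnat_ord lift_perm_id.
    congr Da; apply: funext => j /=; have [pj|jp] := leqP p j.
      by rewrite !pnat_out // ifF //; have := ltn_ord i; lia.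
    rewrite -[j]/(val (Ordinal jp)).
    have -> : (val (Ordinal jp)).+1 = val (lift ord0 (Ordinal jp)) by [].
    rewrite !pnat_ord lift_perm_lift /= /bump.
    by congr v; case: ifP; lia.
  rewrite (alternating_perm _ _ (lD _) (aD _)) [X in _ *: X]scalerA.
  rewrite -signr_addb addbb scale1r signr_odd.
  over.
by rewrite /= sumr_const cardT -cardE card_Sn scaler_nat.
Qed.

End AlternatingMaps.

Lemma mlin_comp (R : numFieldType) (T T' U : lmodType R) p (f : T' -> T)
    (F : (nat -> T) -> U) :
  mlin p F -> linear f -> mlin p (fun v => F (fun j => f (v j))).
Proof.
move=> lF lf v i ip k x y.
have e z : (fun j => f (upd v i z j)) = upd (f \o v) i (f z).
  by apply: funext => j; rewrite /upd /=; case: ifP.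
by rewrite !e lf lF.
Qed.

(** * Functions of class C^k *)

Section NearDifferential.
Context (R : realType) (V W : normedModType R).

(** The expansion characterising ['d] involves only values near x; with the uniqueness of the
    differential, it transfers both differentiability and the differential between functions with
    the same germ. *)
Lemma near_eq_diff_locally (f g : V -> W) x :
  (\near x, f x = g x) -> differentiable f x ->
  g \o shift x = cst (g x) + 'd f x +o_ 0 id.
Proof.
move=> fg /diff_locallyP[_ /eqaddoP fo].
have fgx : f x = g x by exact: nbhs_singleton fg.
apply/eqaddoP => e e0; have foe := fo e e0.
have fg0 : \forall h \near 0, f (h + x) = g (h + x).
  by move: fg; rewrite (near_shift 0 x); apply: filterS => h /=; rewrite subr0.
near=> h.
have -> : (g \o shift x - (cst (g x) + 'd f x)) h =
          (f \o shift x - (cst (f x) + 'd f x)) h.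
  rewrite !fctE /= /cst fgx; congr (_ - _); apply/esym; near: h; exact: fg0.
by near: h; exact: foe.
Unshelve. all: by end_near. Qed.

Lemma near_eq_diff (f g : V -> W) x : (\near x, f x = g x) ->
  differentiable f x -> 'd g x = 'd f x :> (V -> W).
Proof.
by move=> fg df; apply: diff_unique (near_eq_diff_locally fg df);
  have /diff_locallyP[] := df.
Qed.

Lemma near_eq_differentiable (f g : V -> W) x : (\near x, f x = g x) ->
  differentiable f x -> differentiable g x.
Proof.
move=> fg df; apply/diff_locallyP; rewrite (near_eq_diff fg df).
by split; [have /diff_locallyP[] := df|exact: near_eq_diff_locally fg df].
Qed.

End NearDifferential.

Section Ck.
Context (R : realType) (n : nat).
Implicit Types (W : normedModType R) (U : set 'rV[R]_n).

Lemma open_near U u : open U -> U u -> \near u, U u.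
Proof. by move=> oU Uu; exact: open_nbhs_nbhs. Qed.

Lemma Ck_eq W k U (f g : 'rV[R]_n -> W) : open U ->
  (forall u, U u -> f u = g u) -> Ck_on k U f -> Ck_on k U g.
Proof.
move=> oU; elim: k f g => [|k IH] f g fg /=.
  move=> cf u uU; have Uu := set_mem uU.
  rewrite /continuous_at -fg //; apply: cvg_trans (cf u uU).
  apply: (@near_eq_cvg _ _ (nbhs u)); near=> v; rewrite fg //; near: v; exact: open_near.
move=> [df Df]; split => [u Uu|w].
  apply: near_eq_differentiable (df u Uu).
  by apply: filterS (open_near oU Uu) => v; exact: fg.
apply: IH (Df w) => u Uu; apply: near_eq_derive.
by apply: filterS (open_near oU Uu) => v; exact: fg.
Unshelve. all: by end_near. Qed.

Lemma CkW W k U (f : 'rV[R]_n -> W) : Ck_on k.+1 U f -> Ck_on k U f.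
Proof.
elim: k f => [|k IH] f [df Df].
  by move=> u /set_mem Uu; apply: differentiable_continuous; exact: df.
by split=> // w; apply: IH.
Qed.

(** Allows a different chart of the target around each point when a form is pulled back. *)
Lemma Ck_local W k U (f : 'rV[R]_n -> W) :
  (forall u, U u -> exists2 U', U' u & Ck_on k U' f) -> Ck_on k U f.
Proof.
elim: k f => [|k IH] f loc /=.
  by move=> u /set_mem /loc[U' U'u]; apply; apply: mem_set.
split=> [u /loc[U' U'u [df _]]|w]; first exact: df.
by apply: IH => u /loc[U' U'u [_ Df]]; exists U' => //; exact: Df.
Qed.

Lemma Ck_cst W k U (c : W) : Ck_on k U (fun=> c).
Proof.
elim: k c => [|k IH] c /=; first by move=> u _; exact: cst_continuous.
split=> [u _|w]; first exact: differentiable_cst.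
rewrite (_ : derive _ ^~ w = fun=> 0) //.
by apply: funext => u; exact: derive_cst.
Qed.

Lemma CkD W k U (f g : 'rV[R]_n -> W) : open U ->
  Ck_on k U f -> Ck_on k U g -> Ck_on k U (fun u => f u + g u).
Proof.
move=> oU; elim: k f g => [|k IH] f g /=.
  by move=> cf cg u uU; apply: (@continuousD _ _ _ f g u); [exact: cf|exact: cg].
move=> [df Df] [dg Dg]; split=> [u Uu|w].
  exact: (differentiableD (df u Uu) (dg u Uu)).
apply: Ck_eq (IH _ _ (Df w) (Dg w)) => // u Uu.
rewrite -[RHS]/('D_w (f + g) u) deriveD //; apply: diff_derivable.
  exact: df.
exact: dg.
Qed.

Lemma Ck_sum W k U (I : Type) (r : seq I) (P : pred I)
    (f : I -> 'rV[R]_n -> W) : open U ->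
  (forall i, Ck_on k U (f i)) -> Ck_on k U (fun u => \sum_(i <- r | P i) f i u).
Proof.
move=> oU Cf; elim: r => [|i r IH].
  by under eq_fun do rewrite big_nil; exact: Ck_cst.
under eq_fun do rewrite big_cons.
by case: (P i) => //; apply: CkD.
Qed.

(** Scaling is a continuous bilinear map, so this is the chain rule through the pair of r and f. *)
Lemma derive_scalev W (r : 'rV[R]_n -> R) (f : 'rV[R]_n -> W) u w :
  differentiable r u -> differentiable f u ->
  differentiable (fun u => r u *: f u) u /\
  'D_w (fun u => r u *: f u) u = 'D_w r u *: f u + r u *: 'D_w f u.
Proof.
move=> dr df; pose B (p : R * W) := p.1 *: p.2.
have bil : bilinear_for (GRing.Scale.Law.clone _ _ *:%R _)
    (GRing.Scale.Law.clone _ _ *:%R _) (fun (k : R) (x : W) => k *: x).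
  by split=> [x|k] a y z /=; rewrite ?scalerDl ?scalerDr !scalerA // mulrC.
pose bilM := bilinear_isBilinear.Build _ _ _ _ _ _ _ bil.
pose bilL : {bilinear R -> W -> W} :=
  HB.pack (fun (k : R) (x : W) => k *: x) bilM.
have cB : continuous (fun p : R * W => bilL p.1 p.2).
  exact: scale_continuous.
have dp : differentiable (fun u => (r u, f u)) u by exact: differentiable_pair.
have dB : differentiable (fun p : R * W => bilL p.1 p.2) (r u, f u).
  exact: differentiable_bilin.
have dc : differentiable (fun u => r u *: f u) u.
  exact: (differentiable_comp dp dB).
split=> //; rewrite !deriveE //.
apply: etrans (congr1 (@^~ w) (diff_comp dp dB)) _.
apply: etrans (congr1 (@^~ ('d (fun u => (r u, f u)) u w))
  (diff_bilin (r u, f u) cB)) _.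
apply: etrans (congr1 (fun z : R * W => r u *: z.2 + z.1 *: f u)
  (congr1 (@^~ w) (diff_pair dr df))) _.
by rewrite addrC.
Qed.

Lemma CkZ W k U (r : 'rV[R]_n -> R) (f : 'rV[R]_n -> W) : open U ->
  Ck_on k U (r : _ -> R^o) -> Ck_on k U f -> Ck_on k U (fun u => r u *: f u).
Proof.
move=> oU; elim: k r f => [|k IH] r f.
  move=> cr cf u uU.
  exact: (cvgZ (F := nbhs u) (cr u uU) (cf u uU)).
move=> Cr Cf; have [dr Dr] := Cr; have [df Df] := Cf; split=> [u Uu|w].
  by have [] := derive_scalev 0 (dr u Uu) (df u Uu).
apply: (@Ck_eq _ _ _ (fun u => 'D_w r u *: f u + r u *: 'D_w f u)) => //.
  by move=> u Uu; have [_ ->] := derive_scalev w (dr u Uu) (df u Uu).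
apply: CkD => //; apply: IH => //; try exact: CkW.
  exact: Dr.
exact: Df.
Qed.

End Ck.

(** * Functions with values in R^m: linear and bilinear maps *)

Section RowFunctions.
Context (R : realType) (n : nat).
Implicit Types (W : normedModType R) (U : set 'rV[R]_n).

Lemma differentiable_sumf W (I : Type) (r : seq I) (f : I -> 'rV[R]_n -> W) u :
  (forall i, differentiable (f i) u) ->
  differentiable (fun u => \sum_(i <- r) f i u) u.
Proof.
move=> df; elim: r => [|i r IH].
  under eq_fun do rewrite big_nil; exact: differentiable_cst.
under eq_fun do rewrite big_cons.
exact: differentiableD (df i) IH.
Qed.

Lemma derive_sumf W (I : Type) (r : seq I) (f : I -> 'rV[R]_n -> W) u w :
  (forall i, differentiable (f i) u) ->
  'D_w (fun u => \sum_(i <- r) f i u) u = \sum_(i <- r) 'D_w (f i) u.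
Proof.
move=> df; elim: r => [|i r IH].
  under eq_fun do rewrite big_nil; rewrite big_nil; exact: derive_cst.
under eq_fun do rewrite big_cons.
rewrite big_cons -IH; apply: deriveD; apply: diff_derivable => //.
exact: differentiable_sumf.
Qed.

Lemma differentiable_entry m (F : 'rV[R]_n -> 'rV[R]_m) j u :
  differentiable F u -> differentiable (fun u => F u 0 j : R^o) u.
Proof.
move=> dF; apply: (@differentiable_comp _ _ _ _ F (fun M => M 0 j)) => //.
exact: differentiable_coord.
Qed.

Lemma derive_entry m (F : 'rV[R]_n -> 'rV[R]_m) j u w :
  differentiable F u -> 'D_w (fun u => F u 0 j : R^o) u = ('D_w F u) 0 j.
Proof. by move=> dF; rewrite derive_mx ?mxE //; exact: diff_derivable. Qed.

Lemma lin_expand m (W : lmodType R) (L : 'rV[R]_m -> W) v : linear L ->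
  L v = \sum_j v 0 j *: L (delta_mx 0 j).
Proof.
move=> lL; rewrite {1}[v]row_sum_delta (lin_sum lL).
by apply: eq_bigr => j _; rewrite (linZ lL).
Qed.

(** Expanding [L] along the standard basis leaves scalar functions times constant vectors, to which
    the product rule applies. *)
Lemma diff_linf m W (L : 'rV[R]_m -> W) (F : 'rV[R]_n -> 'rV[R]_m) u :
  linear L -> differentiable F u -> differentiable (fun u => L (F u)) u.
Proof.
move=> lL dF; under eq_fun do rewrite (lin_expand _ lL).
apply: differentiable_sumf => j.
have [] // := derive_scalev (f := fun=> L (delta_mx 0 j)) 0
  (differentiable_entry j dF).
Qed.

Lemma derive_linf m W (L : 'rV[R]_m -> W) (F : 'rV[R]_n -> 'rV[R]_m) u w :
  linear L -> differentiable F u ->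
  'D_w (fun u => L (F u)) u = L ('D_w F u).
Proof.
move=> lL dF; under eq_fun do rewrite (lin_expand _ lL).
have H j := derive_scalev w (differentiable_entry j dF)
  (differentiable_cst (L (delta_mx 0 j)) u).
rewrite derive_sumf => [|j]; last by have [] := H j.
rewrite [RHS](lin_expand _ lL); apply: eq_bigr => j _; have [_ ->] := H j.
by rewrite derive_entry // derive_cst scaler0 addr0.
Qed.

Lemma Ck_entry m k U (F : 'rV[R]_n -> 'rV[R]_m) j : open U ->
  Ck_on k U F -> Ck_on k U (fun u => F u 0 j : R^o).
Proof.
move=> oU; elim: k F => [|k IH] F /=.
  move=> cF u uU.
  apply: (@continuous_comp _ _ _ F (fun M : 'rV[R]_m => M 0 j)); first exact: cF.
  exact: coord_continuous.
move=> [dF DF]; split=> [u Uu|w]; first by apply: differentiable_entry; exact: dF.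
apply: Ck_eq (IH _ (DF w)) => // u Uu.
by rewrite derive_entry //; exact: dF.
Qed.

Lemma Ck_linf m W k U (L : 'rV[R]_m -> W) (F : 'rV[R]_n -> 'rV[R]_m) :
  open U -> linear L -> Ck_on k U F -> Ck_on k U (fun u => L (F u)).
Proof.
move=> oU lL CF; under eq_fun do rewrite (lin_expand _ lL).
by apply: Ck_sum => // j; apply: CkZ => //; [exact: Ck_entry|exact: Ck_cst].
Qed.

Lemma diff_bilinf m1 m2 W (B : 'rV[R]_m1 -> 'rV[R]_m2 -> W)
    (f : 'rV[R]_n -> 'rV[R]_m1) (g : 'rV[R]_n -> 'rV[R]_m2) u w :
  (forall y, linear (B^~ y)) -> (forall x, linear (B x)) ->
  differentiable f u -> differentiable g u ->
  differentiable (fun u => B (f u) (g u)) u /\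
  'D_w (fun u => B (f u) (g u)) u = B ('D_w f u) (g u) + B (f u) ('D_w g u).
Proof.
move=> lBl lBr df dg.
have E u' : B (f u') (g u') = \sum_j f u' 0 j *: B (delta_mx 0 j) (g u').
  exact: (lin_expand _ (lBl (g u'))).
have H j := derive_scalev w (differentiable_entry j df)
  (diff_linf (lBr (delta_mx 0 j)) dg).
under eq_fun do rewrite E.
split; first by apply: differentiable_sumf => j; have [] := H j.
rewrite derive_sumf => [|j]; last by have [] := H j.
rewrite [B ('D_w f u) _](lin_expand _ (lBl _)) [B (f u) _](lin_expand _ (lBl _)).
rewrite -big_split; apply: eq_bigr => j _; have [_ ->] := H j.
by rewrite (derive_entry _ _ df) (derive_linf _ (lBr (delta_mx 0 j)) dg).
Qed.

Lemma Ck_bilinf m1 m2 W k U (B : 'rV[R]_m1 -> 'rV[R]_m2 -> W)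
    (f : 'rV[R]_n -> 'rV[R]_m1) (g : 'rV[R]_n -> 'rV[R]_m2) : open U ->
  (forall y, linear (B^~ y)) -> (forall x, linear (B x)) ->
  Ck_on k U f -> Ck_on k U g -> Ck_on k U (fun u => B (f u) (g u)).
Proof.
move=> oU lBl lBr Cf Cg.
have E u' : B (f u') (g u') = \sum_j f u' 0 j *: B (delta_mx 0 j) (g u').
  exact: (lin_expand _ (lBl (g u'))).
under eq_fun do rewrite E.
apply: Ck_sum => // j; apply: CkZ => //; first exact: Ck_entry.
exact: Ck_linf.
Qed.

End RowFunctions.

Section Composition.
Context (R : realType) (n m : nat).

Lemma derive_comp (W : normedModType R) (F : 'rV[R]_n -> 'rV[R]_m)
    (f : 'rV[R]_m -> W) u w :
  differentiable F u -> differentiable f (F u) ->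
  'D_w (fun u => f (F u)) u = 'd f (F u) ('D_w F u).
Proof.
move=> dF df; rewrite deriveE; last exact: differentiable_comp dF df.
by rewrite deriveE //; exact: (congr1 (@^~ w) (diff_comp dF df)).
Qed.

(** [Ck_on] speaks of derivatives in constant directions, whereas the chain rule differentiates f in
    the direction ['D_w F u], which moves with u. Expanding that direction along the standard basis
    restores constant directions and lets the induction on k proceed. *)
Lemma Ck_comp (W : normedModType R) k (U : set 'rV[R]_n) (U' : set 'rV[R]_m)
    (F : 'rV[R]_n -> 'rV[R]_m) (f : 'rV[R]_m -> W) :
  open U -> (forall u, U u -> U' (F u)) ->
  Ck_on k U F -> Ck_on k U' f -> Ck_on k U (fun u => f (F u)).
Proof.
move=> oU UU; elim: k f => [|k IH] f.
  move=> cF cf u uU; apply: (@continuous_comp _ _ _ F f); first exact: cF.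
  by apply: cf; apply/mem_set/UU/set_mem.
move=> CF Cf; have [dF DF] := CF; have [df Df] := Cf; split=> [u Uu|w].
  exact: differentiable_comp (dF u Uu) (df _ (UU u Uu)).
apply: (@Ck_eq _ _ _ _ _
  (fun u => \sum_j ('D_w F u) 0 j *: 'D_(delta_mx 0 j) f (F u))) => //.
  move=> u Uu; rewrite (derive_comp w (dF u Uu) (df _ (UU u Uu))).
  rewrite [RHS]lin_expand; last exact: linearP.
  by apply: eq_bigr => j _; rewrite (deriveE _ (df _ (UU u Uu))).
apply: Ck_sum => // j; apply: CkZ => //; first by apply: Ck_entry => //; exact: DF.
exact: (IH _ (CkW CF) (Df _)).
Qed.

End Composition.

(** * Symmetry of second derivatives *)

Section Schwarz.
Context (R : realType) (n : nat).

Lemma is_derive_line (f : 'rV[R]_n -> R^o) p v (s : R) :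
  differentiable f (p + s *: v) ->
  is_derive s 1 (fun s : R => f (p + s *: v)) ('D_v f (p + s *: v)).
Proof.
move=> df; pose l (s : R) := p + s *: v.
have ds : is_diff s ( *:%R^~ v) ( *:%R^~ v) by exact: is_diff_scalel.
have dp : differentiable (cst p : R -> 'rV[R]_n) s by exact: differentiable_cst.
have dl : differentiable l s by exact: differentiableD dp (ex_diff (is_diff_def := ds)).
have El : 'd l s 1 = v.
  apply: etrans (congr1 (@^~ 1) (diffD dp (ex_diff (is_diff_def := ds)))) _.
  apply: etrans (congr1 (fun g : R -> 'rV[R]_n => 'd (cst p : R -> 'rV[R]_n) s 1
    + g 1) (diff_val (is_diff_def := ds))) _.
  by rewrite scale1r (congr1 (@^~ 1) (diff_cst p s)) add0r.
apply: DeriveDef.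
  by apply: diff_derivable; exact: differentiable_comp dl df.
rewrite deriveE; last exact: differentiable_comp dl df.
apply: etrans (congr1 (@^~ 1) (diff_comp dl df)) _.
by rewrite deriveE //=; congr ('d f _ _).
Qed.

(** The mean value theorem is used twice: in the direction v for the increment [g] of f along w,
    then along w for ['D_v f]. *)
Lemma second_difference (f : 'rV[R]_n -> R^o) u v w (h : R) : 0 < h ->
  (forall s t, 0 <= s <= h -> 0 <= t <= h ->
     differentiable f (u + s *: v + t *: w) /\
     differentiable ('D_v f) (u + s *: v + t *: w)) ->
  exists s t, [/\ 0 <= s <= h, 0 <= t <= h &
    f (u + h *: v + h *: w) - f (u + h *: v) - f (u + h *: w) + f u
    = 'D_w ('D_v f) (u + s *: v + t *: w) * h * h].
Proof.
move=> h0 df.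
have hh : 0 <= h <= h by rewrite (ltW h0) lexx.
have h00 : (0 : R) <= 0 <= h by apply/andP; split; [exact: lexx|exact: ltW].
pose g (s : R) := f (u + h *: w + s *: v) - f (u + s *: v).
have dg s : 0 <= s <= h -> is_derive s (1 : R) (g : R -> R^o)
    ('D_v f (u + h *: w + s *: v) - 'D_v f (u + s *: v)).
  move=> sh; apply: is_deriveB; apply: is_derive_line.
    by rewrite addrAC; have [] := df s h sh hh.
  by have [] := df s 0 sh h00; rewrite scale0r addr0.
have mvt (k k' : R -> R) :
      (forall s, 0 <= s <= h -> is_derive s (1 : R) (k : R -> R^o) (k' s)) ->
    exists2 s, 0 <= s <= h & k h - k 0 = k' s * h.
  move=> dk; have [||s] := @MVT R k k' 0 h h0.
  - by move=> x; rewrite in_itv /= => /andP[x0 xh]; apply: dk; rewrite !ltW.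
  - apply: derivable_within_continuous => x; rewrite in_itv /= => xh.
    by have [] := dk x xh.
  by rewrite in_itv /= subr0 => /andP[s0 sh]; exists s => //; rewrite !ltW.
have [s sh e1] := mvt _ _ dg.
pose k (t : R) := 'D_v f (u + s *: v + t *: w).
have dk t : 0 <= t <= h -> is_derive t (1 : R) (k : R -> R^o)
    ('D_w ('D_v f) (u + s *: v + t *: w)).
  by move=> th; apply: is_derive_line; have [] := df s t sh th.
have [t th e2] := mvt _ _ dk.
exists s, t; split=> //; rewrite -e2 /k scale0r addr0.
rewrite [u + s *: v + _]addrAC -e1 /g !scale0r !addr0 [u + h *: w + _]addrAC.
ring.
Qed.

(** The second difference is symmetric in v and w, so each mixed derivative, taken at some point
    close to u, yields the same number; continuity at u brings both points back to u. *)
Lemma Schwarz (U : set 'rV[R]_n) (f : 'rV[R]_n -> R^o) u v w :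
  open U -> U u -> Ck_on 2 U f -> 'D_w ('D_v f) u = 'D_v ('D_w f) u.
Proof.
move=> oU Uu [df Df].
have dD v' x : U x -> differentiable ('D_v' f) x.
  by move=> Ux; have [+ _] := Df v'; apply.
have cD v' w' : {for u, continuous ('D_w' ('D_v' f))}.
  by have [_ /(_ w')] := Df v'; apply; apply: mem_set.
have close2 (a b x y e : R) : x = y -> `|a - x| < e / 2 -> `|b - y| < e / 2 ->
    `|a - b| <= e.
  move=> ->; rewrite !ltr_norml !ler_norml => /andP[? ?] /andP[? ?].
  by apply/andP; split; lra.
apply/eqP; rewrite -subr_eq0 -normr_le0; apply/ler_addgt0Pl => e e0.
rewrite addr0.
have e20 : 0 < e / 2 by rewrite divr_gt0.
have := cD v w => /cvgrPdist_lt/(_ _ e20) n1.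
have := cD w v => /cvgrPdist_lt/(_ _ e20) n2.
have [r r0 sub] :=
  (nbhs_normP _ _).1 (filterI (filterI n1 n2) (open_near oU Uu)).
(* With steps of size at most h = r / (2 M), every point reached stays within r / 2 of u; the
   summand 1 keeps [M] positive when v and w vanish. *)
pose M := `|v| + `|w| + 1.
have M0 : 0 < M by rewrite ltr_wpDl // addr_ge0.
pose h := r / (2 * M).
have h0 : 0 < h by rewrite divr_gt0 // mulr_gt0.
(* Stated for [v'] and [w'] so as to serve both orders of the two directions. *)
have inb s t v' w' : `|v'| + `|w'| + 1 = M -> 0 <= s <= h -> 0 <= t <= h ->
    [/\ `|'D_w ('D_v f) u - 'D_w ('D_v f) (u + s *: v' + t *: w')| < e / 2,
        `|'D_v ('D_w f) u - 'D_v ('D_w f) (u + s *: v' + t *: w')| < e / 2 &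
        U (u + s *: v' + t *: w')].
  move=> vw /andP[s0 sh] /andP[t0 th].
  have inball : ball_ (fun x => `|x|) u r (u + s *: v' + t *: w').
    rewrite /ball_ /= -addrA opprD addNKr normrN.
    apply: le_lt_trans (ler_normD _ _) _.
    rewrite !normrZ (ger0_norm s0) (ger0_norm t0).
    apply: (@le_lt_trans _ _ (h * M)).
      rewrite -vw; have := normr_ge0 v'; have := normr_ge0 w'.
      set x := `|v'|; set y := `|w'| => y0 x0.
      have := ler_wpM2r x0 sh; have := ler_wpM2r y0 th; lra.
    have -> : h * M = r / 2 by rewrite /h; field; rewrite gt_eqF.
    by have r1 : 0 < r := r0; lra.
  have [[h1 h2] h3] := sub _ inball.
  by split; [exact: h1|exact: h2|exact: h3].
have [s [t [sh th e1]]] := @second_difference f u v w h h0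
  (fun s t sh th => let: And3 _ _ Ux := inb s t v w erefl sh th in
     conj (df _ Ux) (dD v _ Ux)).
have Mwv : `|w| + `|v| + 1 = M by rewrite /M [`|w| + _]addrC.
have [s' [t' [sh' th' e2]]] := @second_difference f u w v h h0
  (fun s t sh th => let: And3 _ _ Ux := inb s t w v Mwv sh th in
     conj (df _ Ux) (dD w _ Ux)).
have [i1 _ _] := inb s t v w erefl sh th.
have [_ i2 _] := inb s' t' w v Mwv sh' th'.
have e3 : 'D_w ('D_v f) (u + s *: v + t *: w) =
          'D_v ('D_w f) (u + s' *: w + t' *: v).
  apply: (mulIf (lt0r_neq0 h0)); apply: (mulIf (lt0r_neq0 h0)).
  apply: etrans (esym e1) _; apply: etrans _ e2.
  by rewrite [u + h *: w + _]addrAC; congr (_ + _); exact: addrAC.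
exact: close2 e3 i1 i2.
Qed.

End Schwarz.

(** * Derivatives of functions valued in a finite-dimensional space *)

Section Coordinates.
Context (R : realType) (V : vectType R).

Lemma coords_linear : linear (@coords R V).
Proof. exact: passmx.rVof_linear. Qed.

Lemma of_coords_linear : linear (@of_coords R V).
Proof. exact: passmx.vecof_linear. Qed.

Lemma coordsK : cancel (@coords R V) (@of_coords R V).
Proof. by apply: passmx.rVofK; exact: vbasisP. Qed.

Lemma of_coordsK : cancel (@of_coords R V) (@coords R V).
Proof. by apply: passmx.vecofK; exact: vbasisP. Qed.

End Coordinates.

Definition vdiff (R : realType) (n : nat) (V : vectType R)
    (f : 'rV[R]_n -> V) (u : 'rV[R]_n) : Prop :=
  differentiable (fun u' => coords (f u')) u.

Section VectorDerivative.
Context (R : realType) (n : nat).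
Implicit Types (V W X : vectType R) (u w : 'rV[R]_n) (U : set 'rV[R]_n).

Lemma vderive_near V (f g : 'rV[R]_n -> V) u w :
  (\near u, f u = g u) -> vderive f u w = vderive g u w.
Proof.
move=> fg; congr of_coords; apply: near_eq_derive.
by apply: filterS fg => v /= ->.
Qed.

Lemma vderive_dir V (f : 'rV[R]_n -> V) u : vdiff f u -> linear (vderive f u).
Proof.
move=> df k x y; rewrite /vderive !deriveE // linearP.
exact: of_coords_linear.
Qed.

Let conj_linear V W (L : V -> W) : linear L ->
  linear (fun x => coords (L (of_coords x))).
Proof.
by move=> lL k x y; rewrite of_coords_linear lL; exact: coords_linear.
Qed.

Lemma vdiff_lin V W (L : V -> W) (f : 'rV[R]_n -> V) u : linear L ->
  vdiff f u -> vdiff (fun u => L (f u)) u.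
Proof.
move=> lL df; rewrite /vdiff.
under eq_fun => v do rewrite -[f v]coordsK.
apply: (diff_linf (L := fun x => coords (L (of_coords x)))) => //.
exact: conj_linear.
Qed.

Lemma vderive_lin V W (L : V -> W) (f : 'rV[R]_n -> V) u w : linear L ->
  vdiff f u -> vderive (fun u => L (f u)) u w = L (vderive f u w).
Proof.
move=> lL df; rewrite /vderive.
under eq_fun => v do rewrite -[f v]coordsK.
rewrite (derive_linf (L := fun x => coords (L (of_coords x)))) ?coordsK //.
exact: conj_linear.
Qed.

Lemma Ck_lin V W (L : V -> W) k U (f : 'rV[R]_n -> V) : open U -> linear L ->
  Ck_on k U (fun u => coords (f u)) -> Ck_on k U (fun u => coords (L (f u))).
Proof.
move=> oU lL Cf.
under eq_fun => v do rewrite -[f v]coordsK.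
apply: (Ck_linf (L := fun x => coords (L (of_coords x)))) => //.
exact: conj_linear.
Qed.

Section Bilinear.
Context V W X (B : V -> W -> X).
Context (lBl : forall y, linear (B^~ y)) (lBr : forall x, linear (B x)).

Let N x y := coords (B (of_coords x) (of_coords y)).

Let lNl y : linear (N^~ y).
Proof.
move=> k a b; rewrite /N of_coords_linear lBl; exact: coords_linear.
Qed.

Let lNr x : linear (N x).
Proof.
move=> k a b; rewrite /N of_coords_linear lBr; exact: coords_linear.
Qed.

Lemma vdiff_bilin f g u : vdiff f u -> vdiff g u ->
  vdiff (fun u => B (f u) (g u)) u.
Proof.
move=> df dg; rewrite /vdiff.
under eq_fun => v do rewrite -[f v]coordsK -[g v]coordsK.
by have [] := diff_bilinf 0 lNl lNr df dg.
Qed.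

Lemma vderive_bilin f g u w : vdiff f u -> vdiff g u ->
  vderive (fun u => B (f u) (g u)) u w
  = B (vderive f u w) (g u) + B (f u) (vderive g u w).
Proof.
move=> df dg; rewrite /vderive.
under eq_fun => v do rewrite -[f v]coordsK -[g v]coordsK.
have [_ ->] := diff_bilinf w lNl lNr df dg.
by rewrite (linD (@of_coords_linear _ _)) /N !coordsK.
Qed.

Lemma Ck_bilin k U f g : open U ->
  Ck_on k U (fun u => coords (f u)) -> Ck_on k U (fun u => coords (g u)) ->
  Ck_on k U (fun u => coords (B (f u) (g u))).
Proof.
move=> oU Cf Cg.
under eq_fun => v do rewrite -[f v]coordsK -[g v]coordsK.
exact: (Ck_bilinf oU lNl lNr Cf Cg).
Qed.

End Bilinear.

Lemma vdiffZ V (r : 'rV[R]_n -> R) (f : 'rV[R]_n -> V) u :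
  differentiable (r : _ -> R^o) u -> vdiff f u -> vdiff (fun u => r u *: f u) u.
Proof.
move=> dr df; rewrite /vdiff.
under eq_fun => v do rewrite (linZ (@coords_linear _ _)).
by have [] := derive_scalev 0 dr df.
Qed.

Lemma vderiveZ V (r : 'rV[R]_n -> R) (f : 'rV[R]_n -> V) u w :
  differentiable (r : _ -> R^o) u -> vdiff f u ->
  vderive (fun u => r u *: f u) u w
  = 'D_w (r : _ -> R^o) u *: f u + r u *: vderive f u w.
Proof.
move=> dr df; rewrite /vderive.
under eq_fun => v do rewrite (linZ (@coords_linear _ _)).
have [_ ->] := derive_scalev w dr df.
rewrite (linD (@of_coords_linear _ _)) !(linZ (@of_coords_linear _ _)).
by rewrite coordsK.
Qed.

Lemma vdiff_sum V (I : Type) (r : seq I) (f : I -> 'rV[R]_n -> V) u :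
  (forall i, vdiff (f i) u) -> vdiff (fun u => \sum_(i <- r) f i u) u.
Proof.
move=> df; rewrite /vdiff.
under eq_fun => v do rewrite (lin_sum (@coords_linear _ _)).
exact: (@differentiable_sumf _ _ _ _ _ (fun i u => coords (f i u))).
Qed.

Lemma vderive_sum V (I : Type) (r : seq I) (f : I -> 'rV[R]_n -> V) u w :
  (forall i, vdiff (f i) u) ->
  vderive (fun u => \sum_(i <- r) f i u) u w = \sum_(i <- r) vderive (f i) u w.
Proof.
move=> df; rewrite /vderive.
under eq_fun => v do rewrite (lin_sum (@coords_linear _ _)).
rewrite (@derive_sumf _ _ _ _ _ (fun i u => coords (f i u))) //.
exact: (lin_sum (@of_coords_linear _ _)).
Qed.

Lemma vderiveD V (f g : 'rV[R]_n -> V) u w :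
  vdiff f u -> vdiff g u ->
  vderive (fun u => f u + g u) u w = vderive f u w + vderive g u w.
Proof.
move=> df dg; rewrite /vderive.
under eq_fun => v do rewrite (linD (@coords_linear _ _)).
apply: etrans (congr1 (@of_coords _ _) (deriveD _ _)) _.
- exact: diff_derivable df.
- exact: diff_derivable dg.
- exact: (linD (@of_coords_linear _ _)).
Qed.

Lemma vdiff_comp m V (F : 'rV[R]_n -> 'rV[R]_m) (f : 'rV[R]_m -> V) u :
  differentiable F u -> vdiff f (F u) -> vdiff (fun u => f (F u)) u.
Proof. by move=> dF df; exact: differentiable_comp dF df. Qed.

Lemma vderive_comp m V (F : 'rV[R]_n -> 'rV[R]_m) (f : 'rV[R]_m -> V) u w :
  differentiable F u -> vdiff f (F u) ->
  vderive (fun u => f (F u)) u w = vderive f (F u) ('D_w F u).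
Proof.
move=> dF df; rewrite /vderive (derive_comp w dF df).
by congr of_coords; apply/esym; exact: deriveE.
Qed.

End VectorDerivative.

(** * Pullback of forms between open sets *)

Section Slots.
Context (R : realType) (n m p : nat) (V : vectType R).
Context (om : 'rV[R]_m -> (nat -> 'rV[R]_m) -> V).
Context (om_mlin : forall y, mlin p (om y)).

Lemma mlin_vderive y h : (forall v, vdiff (om^~ v) y) ->
  mlin p (fun v => vderive (om^~ v) y h).
Proof.
move=> dom v i ip k a b.
rewrite /vderive.
have -> : (fun u' => coords (om u' (upd v i (k *: a + b)))) =
  (k *: (fun u' => coords (om u' (upd v i a)))) +
  (fun u' => coords (om u' (upd v i b))).
  by apply: funext => z; rewrite om_mlin // coords_linear.
rewrite deriveD; last 2 first.
- by apply: derivableZ; apply: diff_derivable; exact: dom.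
- by apply: diff_derivable; exact: dom.
rewrite deriveZ; last by apply: diff_derivable; exact: dom.
exact: of_coords_linear.
Qed.

Context (F : 'rV[R]_n -> 'rV[R]_m) (g : nat -> 'rV[R]_n -> 'rV[R]_m).

(* The product rule for [om (F u)] evaluated on the vector fields [g i] is proved
   by letting the slots vary one after the other, the others being constant. *)
Definition slots (k : nat) (v : nat -> 'rV[R]_m) (u : 'rV[R]_n) (i : nat) :=
  if (i < k)%N then g i u else v i.

Lemma slots0 v u : slots 0 v u = v.
Proof. by apply: funext. Qed.

Lemma slots_upd k v a u : slots k (upd v k a) u = upd (slots k v u) k a.
Proof.
by apply: funext => i; rewrite /slots /upd; case_ifs => //; lia.
Qed.

Lemma slotsS k v u : slots k.+1 v u = upd (slots k v u) k (g k u).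
Proof.
by apply: funext => i; rewrite /slots /upd; case_ifs => //; try lia; congr g; lia.
Qed.

Lemma slots_expand k v u : (k < p)%N ->
  om (F u) (slots k.+1 v u) =
  \sum_j (g k u) 0 j *: om (F u) (slots k (upd v k (delta_mx 0 j)) u).
Proof.
move=> kp; rewrite slotsS (lin_expand _ (om_mlin _ _ kp)).
by apply: eq_bigr => j _; rewrite slots_upd.
Qed.

(** The slot that starts to vary is expanded along the standard basis: its dependence on u then sits
    in scalar coefficients, and the product rule for scalar multiples suffices. *)
Lemma vderive_slots k v u h : (k <= p)%N -> differentiable F u ->
  (forall i, (i < k)%N -> differentiable (g i) u) ->
  (forall v, vdiff (om^~ v) (F u)) ->
  vdiff (fun u => om (F u) (slots k v u)) u /\
  vderive (fun u => om (F u) (slots k v u)) u h =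
    vderive (om^~ (slots k v u)) (F u) ('D_h F u) +
    \sum_(i < k) om (F u) (upd (slots k v u) i ('D_h (g i) u)).
Proof.
move=> + dF + dom; elim: k v => [|k IH] v kp dg.
  under eq_fun => x do rewrite slots0.
  rewrite big_ord0 addr0 slots0; split.
    exact: (vdiff_comp (f := om^~ v) dF (dom v)).
  exact: (vderive_comp h (f := om^~ v) dF (dom v)).
have IHj j := IH (upd v k (delta_mx 0 j)) (ltnW kp) (fun i ik => dg i (ltnW ik)).
have dgk : differentiable (g k) u by exact: dg.
under eq_fun => x do rewrite slots_expand //.
split.
  apply: vdiff_sum => j; apply: vdiffZ; first exact: differentiable_entry.
  by have [] := IHj j.
rewrite vderive_sum => [|j]; last first.
  apply: vdiffZ; first exact: differentiable_entry.
  by have [] := IHj j.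
under eq_bigr => j _.
  rewrite (vderiveZ h (differentiable_entry j dgk) (IHj j).1) (IHj j).2.
  rewrite (derive_entry _ _ dgk) slots_upd scalerDr.
  over.
rewrite 2!big_split /=.
under [X in _ + (_ + X)]eq_bigr => j _ do rewrite scaler_sumr.
rewrite [X in _ + (_ + X)]exchange_big /= slotsS addrC -addrA; congr (_ + _).
  by rewrite [RHS](lin_expand _ (mlin_vderive _ dom _ kp)).
rewrite big_ord_recr /=; congr (_ + _); last first.
  by rewrite upd_upd [RHS](lin_expand _ (om_mlin _ _ kp)).
apply: eq_bigr => i _; rewrite upd_swap; last by have := ltn_ord i; lia.
rewrite [RHS](lin_expand _ (om_mlin _ _ kp)); apply: eq_bigr => j _.
by rewrite upd_swap //; have := ltn_ord i; lia.
Qed.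

Lemma Ck_slots l k v (U : set 'rV[R]_n) (U' : set 'rV[R]_m) : (k <= p)%N ->
  open U -> (forall u, U u -> U' (F u)) -> Ck_on l U F ->
  (forall i, (i < k)%N -> Ck_on l U (g i)) ->
  (forall v, Ck_on l U' (fun y => coords (om y v))) ->
  Ck_on l U (fun u => coords (om (F u) (slots k v u))).
Proof.
move=> + oU UU CF + Com; elim: k v => [|k IH] v kp Cg.
  under eq_fun => x do rewrite slots0.
  exact: (Ck_comp oU UU CF (Com v)).
under eq_fun => x do rewrite slots_expand // (lin_sum (@coords_linear _ _)).
apply: Ck_sum => // j.
under eq_fun => x do rewrite (linZ (@coords_linear _ _)).
apply: CkZ => //; first by apply: Ck_entry => //; exact: Cg.
by apply: IH => [|i ik]; [exact: ltnW|apply: Cg; exact: ltnW].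
Qed.

End Slots.

Section FlatForms.
Context (R : realType) (n m p : nat) (V : vectType R).

Definition pull (F : 'rV[R]_n -> 'rV[R]_m)
    (om : 'rV[R]_m -> (nat -> 'rV[R]_m) -> V) (u : 'rV[R]_n)
    (v : nat -> 'rV[R]_n) : V :=
  om (F u) (fun i => 'd F u (v i)).

Lemma Schwarz_row (U : set 'rV[R]_n) (F : 'rV[R]_n -> 'rV[R]_m) u v w :
  open U -> U u -> Ck_on 2 U F -> 'D_w ('D_v F) u = 'D_v ('D_w F) u.
Proof.
move=> oU Uu CF; have [dF DF] := CF.
have dDF v' : differentiable ('D_v' F) u by have [+ _] := DF v'; apply.
apply/rowP => j.
have E v' w' : 'D_w' (fun u => 'D_v' F u 0 j : R^o) u =
    'D_w' ('D_v' (fun u => F u 0 j : R^o)) u.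
  apply: near_eq_derive; apply: filterS (open_near oU Uu) => x Ux.
  by apply/esym; exact: (derive_entry j v' (dF x Ux)).
apply: etrans (esym (derive_entry j w (dDF v))) _.
apply: etrans (E v w) _.
apply: etrans _ (derive_entry j v (dDF w)).
apply: etrans _ (esym (E w v)).
exact: Schwarz oU Uu (Ck_entry j oU CF).
Qed.

End FlatForms.

(** Fed to [nD p], this gives the exterior derivative at u of a p-form on an open set of R^n. *)
Definition Dform (R : realType) (n : nat) (V : vectType R)
    (om : 'rV[R]_n -> (nat -> 'rV[R]_n) -> V) (u h : 'rV[R]_n)
    (v : nat -> 'rV[R]_n) : V :=
  vderive (om^~ v) u h.

Lemma nD_pull (R : realType) (n m p : nat) (V : vectType R)
    (om : 'rV[R]_m -> (nat -> 'rV[R]_m) -> V) (U : set 'rV[R]_n)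
    (F : 'rV[R]_n -> 'rV[R]_m) u v :
  open U -> U u -> Ck_on 2 U F -> (forall y, mlin p (om y)) ->
  (forall y, dep p (om y)) -> (forall v, vdiff (om^~ v) (F u)) ->
  nD p (Dform (pull F om) u) v = nD p (Dform om (F u)) (fun i => 'd F u (v i)).
Proof.
move=> oU Uu CF lom deom dom; have [dF DF] := CF.
(* The second derivative of F at u, of which only the symmetry and the values as iterated
   derivatives are kept. *)
have [H HC HE] : exists2 H : 'rV[R]_n -> 'rV[R]_n -> 'rV[R]_m,
    (forall a b, H a b = H b a) & (forall a b, 'D_a ('D_b F) u = H a b).
  exists (fun a b => 'D_a ('D_b F) u) => [a b|//].
  exact: Schwarz_row oU Uu CF.
have dDF v' : differentiable ('D_v' F) u by have [+ _] := DF v'; apply.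
have step h w : Dform (pull F om) u h w =
    vderive (om^~ (fun i => 'd F u (w i))) (F u) ('d F u h) +
    \sum_(i < p) om (F u) (upd (fun i => 'd F u (w i)) i (H h (w i))).
  (* Near u the vector ['d F x (w i)] is ['D_(w i) F x], so the slots are filled by these vector
     fields; the default 0 from slot p on is never read. *)
  pose g i := 'D_(w i) F.
  have sg x : U x -> forall v', om (F x) (slots g p v' x) = pull F om x w.
    move=> Ux v'; apply: deom => j jp.
    by rewrite /slots jp /g deriveE //; exact: dF.
  have -> : Dform (pull F om) u h w =
      vderive (fun x => om (F x) (slots g p (fun=> 0) x)) u h.
    apply: vderive_near; apply: filterS (open_near oU Uu) => x Ux.
    by rewrite sg.
  have [_ ->] := vderive_slots lom (F := F) (g := g) (fun=> 0) h (leqnn p)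
    (dF u Uu)
    (fun i _ => dDF (w i)) dom.
  apply: (congr2 +%R).
    rewrite -(deriveE _ (dF u Uu)).
    apply: (congr1 (fun q => vderive q (F u) ('D_h F u))); apply: funext => y.
    apply: deom => j jp; rewrite /slots jp /g; exact: deriveE (dF u Uu).
  apply: eq_bigr => i _; apply: deom => j jp; rewrite /upd /slots jp /g.
  case: ifP => _; [exact: HE|exact: deriveE (dF u Uu)].
apply: (congr1 ( *:%R _)).
apply: etrans (eq_Alt _ _ (fun w => step (w 0%N) (w \o succn))) _.
apply: etrans (AltD _ _ _ _) _.
rewrite [X in _ + X](_ : _ = 0); first exact: addr0.
rewrite Alt_sum big1 // => i _.
set K := (fun w : nat -> 'rV[R]_n => om _ _).
have ip : (i.+1 < p.+1)%N by rewrite ltnS.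
(* The transposition of arguments 0 and i + 1 exchanges the direction of differentiation with the
   vector in slot i, that is, the two arguments of [H]. *)
apply: eq_self_opp.
rewrite -scaleN1r -[-1]expr1 -(Alt_sgn _ _ (sgn_swapn (ltn0Sn p) ip isT)).
apply: eq_Alt => w; apply: (congr1 (om (F u))); apply: funext => j.
rewrite /upd /swapn /=; case: ifP => ji; first by rewrite eqxx; exact: HC.
by rewrite eqSS ji.
Qed.

(** * Charts *)

Section Charts.
Context (R : realType).
Implicit Types (M N L : manifold R).

Lemma cinvK M (c : chart R M (mdim M)) u : (cmap c @` cdom c) u ->
  cdom c (cinv c u) /\ cmap c (cinv c u) = u.
Proof. by case=> x cx <-; rewrite cmapK. Qed.

Lemma chart_at_atlas M (x : M) : matlas (chart_at x).
Proof. exact: s2valP. Qed.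

Lemma chart_at_dom M (x : M) : cdom (chart_at x) x.
Proof. exact: (s2valP' (cid2 (atlas_cover (mstruct M) x))). Qed.

Definition base M (x : M) := cmap (chart_at x) x.

Lemma base_img M (x : M) : (cmap (chart_at x) @` cdom (chart_at x)) (base x).
Proof. by exists x => //; exact: chart_at_dom. Qed.

Lemma cinv_base M (x : M) : cinv (chart_at x) (base x) = x.
Proof. by apply: cmapK; exact: chart_at_dom. Qed.

Definition locdom M N (f : M -> N) (c : chart R M (mdim M))
    (c' : chart R N (mdim N)) : set 'rV[R]_(mdim M) :=
  cmap c @` (cdom c `&` f @^-1` cdom c').

Definition loc M N (f : M -> N) (c : chart R M (mdim M))
    (c' : chart R N (mdim N)) : 'rV[R]_(mdim M) -> 'rV[R]_(mdim N) :=
  cmap c' \o f \o cinv c.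

Lemma locdomP M N (f : M -> N) c c' u :
  locdom f c c' u <-> (cmap c @` cdom c) u /\ cdom c' (f (cinv c u)).
Proof.
split=> [[x [cx c'x] <-]|[[x cx <-] c'x]].
  by rewrite (cmapK cx); split => //; exists x.
by rewrite (cmapK cx) in c'x; exists x.
Qed.

Lemma open_locdom M N (f : M -> N) c c' : continuous f -> open (locdom f c c').
Proof.
move=> cf; rewrite openE => u /locdomP[cu c'u].
have n1 : \forall x \near u, (cmap c @` cdom c) x.
  by apply: open_near => //; exact: cimg_open.
have n2 : \forall x \near u, cdom c' (f (cinv c x)).
  have ci : {for u, continuous (cinv c)}.
    by apply: cinv_continuous; exact: mem_set.
  have cfi := @continuous_comp _ _ _ (cinv c) f u ci (cf (cinv c u)).
  by apply: cfi; apply: open_nbhs_nbhs; split => //; exact: cdom_open.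
by apply: filterS (filterI n1 n2) => x [x1 x2]; apply/locdomP.
Qed.

Lemma smooth_map_id M : smooth_map (@id M).
Proof.
split; first by move=> x; exact: cvg_id.
by move=> c c' cM c'M; exact: (atlas_smooth cM c'M).
Qed.

Lemma loc_smooth M N (f : M -> N) c c' k : smooth_map f -> matlas c ->
  matlas c' -> Ck_on k (locdom f c c') (loc f c c').
Proof. by case=> _ sf cM c'N; exact: sf. Qed.

Lemma loc_diff M N (f : M -> N) c c' u : smooth_map f -> matlas c ->
  matlas c' -> locdom f c c' u -> differentiable (loc f c c') u.
Proof.
by move=> sf cM c'N cu; have [df _] := loc_smooth 1 sf cM c'N; exact: df.
Qed.

Lemma loc_comp_diff M N L (f : M -> N) (g : N -> L) c c' c'' u v :
  smooth_map f -> smooth_map g -> matlas c -> matlas c' -> matlas c'' ->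
  (cmap c @` cdom c) u -> cdom c' (f (cinv c u)) -> cdom c'' (g (f (cinv c u))) ->
  'd (loc (g \o f) c c'') u v =
  'd (loc g c' c'') (loc f c c' u) ('d (loc f c c') u v).
Proof.
move=> sf sg cM c'N c''L cu c'u c''u.
have fu : locdom f c c' u by apply/locdomP.
have locK u' : locdom f c c' u' -> cinv c' (loc f c c' u') = f (cinv c u').
  by move=> /locdomP[_ c'u']; rewrite /loc /= cmapK.
have gu : locdom g c' c'' (loc f c c' u).
  apply/locdomP; split; first by exists (f (cinv c u)).
  by rewrite locK.
have df := loc_diff sf cM c'N fu.
have dg := loc_diff sg c'N c''L gu.
have ne : \near u, (loc g c' c'' \o loc f c c') u = loc (g \o f) c c'' u.
  have oU : open (locdom f c c') by apply: open_locdom; exact: sf.1.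
  apply: filterS (open_near oU fu) => x fx.
  by rewrite /comp /loc /= cmapK //; have [] := (locdomP _ _ _ _).1 fx.
apply: etrans (congr1 (@^~ v) (near_eq_diff ne (differentiable_comp df dg))) _.
exact: (congr1 (@^~ v) (diff_comp df dg)).
Qed.

Lemma mdiff_id M (x : M) v : mdiff (@id M) x v = v.
Proof.
have ne : \forall u \near base x, id u = loc (@id M) (chart_at x) (chart_at x) u.
  have oU := @cimg_open _ _ _ (chart_at x).
  apply: filterS (open_near oU (base_img x)) => u /cinvK[_ e].
  by rewrite /loc /= e.
have did := ex_diff (is_diff_def := is_diff_id (base x)).
apply: etrans (congr1 (@^~ v) (near_eq_diff ne did)) _.
exact: (congr1 (@^~ v) (diff_val (is_diff_def := is_diff_id (base x)))).
Qed.

Lemma mdiff_comp M N L (f : M -> N) (g : N -> L) x v :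
  smooth_map f -> smooth_map g ->
  mdiff (g \o f) x v = mdiff g (f x) (mdiff f x v).
Proof.
move=> sf sg.
apply: etrans (loc_comp_diff (c := chart_at x) (c' := chart_at (f x))
  (c'' := chart_at (g (f x))) v sf sg _ _ _ _ _ _) _;
  rewrite -?/(base x) ?cinv_base; try exact: chart_at_atlas;
  try exact: chart_at_dom; first exact: base_img.
have e : loc f (chart_at x) (chart_at (f x)) (base x) = base (f x).
  by rewrite /loc /= cinv_base.
exact: (congr1 (fun z => 'd (loc g (chart_at (f x)) (chart_at (g (f x)))) z
  (mdiff f x v)) e).
Qed.

(** The inner differential is that of the local expression of the identity from c to the chosen
    chart, so this is the chain rule for f composed with the identity. *)
Lemma mdiff_frame M N (f : M -> N) c c' u v : smooth_map f ->
  matlas c -> matlas c' -> (cmap c @` cdom c) u -> cdom c' (f (cinv c u)) ->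
  'd (loc f (chart_at (cinv c u)) c') (base (cinv c u))
    ('d (cmap (chart_at (cinv c u)) \o cinv c) u v)
  = 'd (loc f c c') u v.
Proof.
move=> sf cM c'N cu c'u; apply/esym.
apply: (loc_comp_diff (f := id) (c' := chart_at (cinv c u)) v (@smooth_map_id M) sf) => //.
- exact: chart_at_atlas.
- exact: chart_at_dom.
Qed.

Lemma in_chart_pullback M N (f : M -> N) (V : vectType R) p
    (w : preform N V p) c c' u v :
  smooth_map f -> matlas c -> matlas c' ->
  (cmap c @` cdom c) u -> cdom c' (f (cinv c u)) ->
  in_chart (pullback f w) c u v =
  in_chart w c' (loc f c c' u) (fun i => 'd (loc f c c') u (v i)).
Proof.
move=> sf cM c'N cu c'u; set y := cinv c u.
have e : cinv c' (loc f c c' u) = f y by rewrite /loc /= cmapK.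
rewrite /in_chart /pullback e; congr (w _); apply: funext => i.
apply: etrans (mdiff_frame (c' := chart_at (f y)) (v i) sf cM _ cu _) _.
- exact: chart_at_atlas.
- exact: chart_at_dom.
apply: (loc_comp_diff (g := id) (c' := c') (v i) sf (@smooth_map_id N)) => //.
- exact: chart_at_atlas.
- exact: chart_at_dom.
Qed.

(** A change of charts is the pullback by the identity map, so facts about pullbacks cover it. *)
Lemma in_chart_change M (V : vectType R) p (w : preform M V p) c c' u v :
  matlas c -> matlas c' -> (cmap c @` cdom c) u -> cdom c' (cinv c u) ->
  in_chart w c u v =
  in_chart w c' (loc id c c' u) (fun i => 'd (loc id c c') u (v i)).
Proof.
move=> cM c'M cu c'u.
rewrite -(in_chart_pullback w v (@smooth_map_id M)) //.
rewrite /in_chart /pullback; congr (w _); apply: funext => i.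
by rewrite mdiff_id.
Qed.

Lemma in_chart_base M (V : vectType R) p (w : preform M V p) x v :
  in_chart w (chart_at x) (base x) v = w x v.
Proof.
rewrite /in_chart cinv_base; congr (w _); apply: funext => i.
exact: mdiff_id.
Qed.

End Charts.

(** * Forms on manifolds *)

Section NatForms.
Context (R : realType).
Implicit Types (M N : manifold R) (U V W : vectType R).

(* Forms read on infinite argument lists: this makes the transport of forms along
   equalities of degrees invisible. *)
Definition nform M V p (w : preform M V p) (x : M)
    (v : nat -> 'rV[R]_(mdim M)) : V := w x (fun i : 'I_p => v i).

Definition nchart M V p (w : preform M V p) (c : chart R M (mdim M))
    (u : 'rV[R]_(mdim M)) (v : nat -> 'rV[R]_(mdim M)) : V :=
  in_chart w c u (fun i : 'I_p => v i).

Definition ext0 (T : zmodType) p (v : 'I_p -> T) (j : nat) : T :=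
  if insub j is Some i then v i else 0.

Lemma ext0_ord (T : zmodType) p (v : 'I_p -> T) (i : 'I_p) : ext0 v i = v i.
Proof. by rewrite /ext0 valK. Qed.

Lemma nform_ext0 M V p (w : preform M V p) x v : nform w x (ext0 v) = w x v.
Proof. by congr (w x); apply: funext => i; rewrite ext0_ord. Qed.

Lemma nform_inj M V p (w w' : preform M V p) :
  (forall x v, nform w x v = nform w' x v) -> w = w'.
Proof.
move=> ww; apply: funext => x; apply: funext => v.
by rewrite -!nform_ext0 ww.
Qed.

Lemma dep_nform M V p (w : preform M V p) x : dep p (nform w x).
Proof.
by move=> v v' vv; congr (w x); apply: funext => i; exact: vv.
Qed.

Lemma dep_nchart M V p (w : preform M V p) c u : dep p (nchart w c u).
Proof.
by move=> v v' vv; congr in_chart; apply: funext => i; exact: vv.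
Qed.

Lemma nchartE M V p (w : preform M V p) c u v :
  nchart w c u v = nform w (cinv c u)
    (fun i => 'd (cmap (chart_at (cinv c u)) \o cinv c) u (v i)).
Proof. by []. Qed.

Lemma nchart_base M V p (w : preform M V p) x v :
  nchart w (chart_at x) (base x) v = nform w x v.
Proof. exact: in_chart_base. Qed.

Lemma nform_wedge M U V W (B : U -> V -> W) p q (a : preform M U p)
    (b : preform M V q) x v :
  nform (wedge B a b) x v = nwedge B p q (nform a x) (nform b x) v.
Proof.
rewrite nwedge.unlock; apply: (congr1 ( *:%R _)); apply: eq_bigr => s _.
apply: (congr1 ( *:%R _)); rewrite /nform; congr (B (a x _) (b x _));
  apply: funext => i /=.
  by rewrite -(pnat_ord s (lshift q i)).
by rewrite -(pnat_ord s (rshift p i)).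
Qed.

Lemma nform_mlin M V p (w : preform M V p) x : is_form w -> mlin p (nform w x).
Proof.
move=> fw v i ip k a b.
have E z : nform w x (upd v i z) =
    w x [eta (fun i : 'I_p => v i) with Ordinal ip |-> z].
  by rewrite /nform; congr (w x); apply: funext => j; rewrite /upd /= -val_eqE.
by rewrite !E (form_multilinear fw).
Qed.

Lemma nform_alternating M V p (w : preform M V p) x :
  is_form w -> alternating p (nform w x).
Proof.
move=> fw v i j ip jp ij vij.
by apply: (form_alternating fw x (i := Ordinal ip) (j := Ordinal jp)).
Qed.

Lemma nchart_mlin M V p (w : preform M V p) c u :
  is_form w -> mlin p (nchart w c u).
Proof.
move=> fw; apply: (mlin_comp (f := 'd (cmap (chart_at (cinv c u)) \o cinv c) u)
  (nform_mlin (cinv c u) fw)); exact: linearP.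
Qed.

Lemma nchart_alternating M V p (w : preform M V p) c u :
  is_form w -> alternating p (nchart w c u).
Proof.
move=> fw v i j ip jp ij vij.
have := nform_alternating (cinv c u) fw
  (v := fun i => 'd (cmap (chart_at (cinv c u)) \o cinv c) u (v i)) ip jp ij.
by rewrite vij; exact.
Qed.

Lemma nchart_smooth M V p (w : preform M V p) c k v : is_form w -> matlas c ->
  Ck_on k (cmap c @` cdom c) (fun u => coords (nchart w c u v)).
Proof. by move=> fw cM; exact: (form_smooth fw _ cM). Qed.

Lemma nchart_vdiff M V p (w : preform M V p) c u v : is_form w -> matlas c ->
  (cmap c @` cdom c) u -> vdiff (nchart w c ^~ v) u.
Proof.
by move=> fw cM cu; have [df _] := nchart_smooth 1 v fw cM; exact: df.
Qed.

Lemma is_formI M V p (w : preform M V p) :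
  (forall x, mlin p (nform w x)) -> (forall x, alternating p (nform w x)) ->
  (forall c v k, matlas c ->
     Ck_on k (cmap c @` cdom c) (fun u => coords (nchart w c u v))) ->
  is_form w.
Proof.
move=> lw aw sw; split=> [x v i k a b|x v i j ij vij|c v cM k].
- have E z : w x [eta v with i |-> z] = nform w x (upd (ext0 v) i z).
    rewrite /nform; congr (w x); apply: funext => j.
    by rewrite /upd /= -val_eqE; case: ifP => // _; rewrite ext0_ord.
  by rewrite !E lw.
- rewrite -nform_ext0; apply: (aw x _ i j) => //.
  by rewrite !ext0_ord.
- have := sw c (ext0 v) k cM; congr Ck_on; apply: funext => u.
  congr (coords (in_chart _ _ _ _)); apply: funext => i.
  exact: ext0_ord.
Qed.

(** The definition of [dform] omits one argument at a time; [nD_head] turns this into an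
    alternation, since the differentiated coefficients are again multilinear and alternating. *)
Lemma nform_dform M V p (w : preform M V p) x v : is_form w ->
  nform (dform w) x v = nD p (Dform (nchart w (chart_at x)) (base x)) v.
Proof.
move=> fw; rewrite nD_head.
- apply: eq_bigr => i _; apply: (congr1 ( *:%R _)).
  apply: (congr1 (fun F => vderive F (base x) (v i))); apply: funext => u.
  apply: (congr1 (in_chart w (chart_at x) u)); apply: funext => j.
  by rewrite /= /bump; congr v; case: ifP; lia.
- move=> h; apply: mlin_vderive => [y|v']; first exact: nchart_mlin.
  by apply: nchart_vdiff => //; [exact: chart_at_atlas|exact: base_img].
- move=> h v' i j ip jp ij vij; rewrite /Dform.
  rewrite (_ : (fun y => _) = fun=> 0); last first.
    by apply: funext => y; exact: nchart_alternating vij.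
  rewrite /vderive (lin0 (@coords_linear _ _)) derive_cst.
  exact: (lin0 (@of_coords_linear _ _)).
Qed.

Lemma nchart_pullback M N (f : M -> N) V p (w : preform N V p) c c' u v :
  smooth_map f -> matlas c -> matlas c' ->
  (cmap c @` cdom c) u -> cdom c' (f (cinv c u)) ->
  nchart (pullback f w) c u v = pull (loc f c c') (nchart w c') u v.
Proof. by move=> *; exact: in_chart_pullback. Qed.

Lemma nchart_change M V p (w : preform M V p) c c' u v :
  matlas c -> matlas c' -> (cmap c @` cdom c) u -> cdom c' (cinv c u) ->
  nchart w c u v = pull (loc id c c') (nchart w c') u v.
Proof. by move=> *; exact: in_chart_change. Qed.

Lemma nD_near (n p : nat) V (om om' : 'rV[R]_n -> (nat -> 'rV[R]_n) -> V) u v :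
  (\forall u \near u, forall v, om u v = om' u v) ->
  nD p (Dform om u) v = nD p (Dform om' u) v.
Proof.
move=> near_om; apply: (congr1 ( *:%R _)); apply: eq_Alt => w.
by apply: vderive_near; apply: filterS near_om => x; exact.
Qed.

(** At y, [dform] differentiates in the chart chosen at y, which changes with y in an uncontrolled
    way. By [nD_pull] for the change of charts, the result is also the derivative in the fixed chart
    c, where smoothness can be read off. *)
Lemma nchart_dform M V p (w : preform M V p) c u v : is_form w -> matlas c ->
  (cmap c @` cdom c) u ->
  nchart (dform w) c u v = nD p (Dform (nchart w c) u) v.
Proof.
move=> fw cM cu; set y := cinv c u.
have cy : locdom id c (chart_at y) u.
  by apply/locdomP; split => //; exact: chart_at_dom.
have oU : open (locdom id c (chart_at y)).
  by apply: open_locdom; exact: (@smooth_map_id _ M).1.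
have yM := chart_at_atlas y.
have e : loc id c (chart_at y) u = base y by [].
rewrite nchartE; apply: etrans (nform_dform _ _ fw) _.
apply: etrans (esym (nD_pull (F := loc id c (chart_at y)) v oU cy _ _ _ _)) _.
- exact: loc_smooth (@smooth_map_id _ M) cM yM.
- by move=> z; exact: nchart_mlin.
- by move=> z; exact: dep_nchart.
- by move=> v'; apply: nchart_vdiff => //; exact: base_img.
apply: nD_near; apply: filterS (open_near oU cy) => x /locdomP[x1 x2] v'.
by apply/esym; exact: nchart_change.
Qed.

Lemma is_form_dform M V p (w : preform M V p) : is_form w -> is_form (dform w).
Proof.
move=> fw.
have E x : nform (dform w) x = nD p (Dform (nchart w (chart_at x)) (base x)).
  by apply: funext => v; exact: nform_dform.
apply: is_formI => [x|x|c v k cM].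
- rewrite E; apply: mlin_nD => [v|h].
    apply: vderive_dir; apply: nchart_vdiff => //; first exact: chart_at_atlas.
    exact: base_img.
  apply: mlin_vderive => [y|v']; first exact: nchart_mlin.
  by apply: nchart_vdiff => //; [exact: chart_at_atlas|exact: base_img].
- by rewrite E; exact: alternating_nD.
- have oc : open (cmap c @` cdom c) by exact: cimg_open.
  apply: (@Ck_eq _ _ _ _ _ (fun u => coords (nD p (Dform (nchart w c) u) v))) => //.
    by move=> u cu; rewrite nchart_dform.
  rewrite /nD /Alt.
  under eq_fun => u.
    rewrite (linZ (@coords_linear _ _)) (lin_sum (@coords_linear _ _)).
    under eq_bigr => s _.
      rewrite (linZ (@coords_linear _ _)) /Dform /vderive of_coordsK.
      over.
    over.
  apply: CkZ => //; first exact: Ck_cst.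
  apply: Ck_sum => // s; apply: CkZ => //; first exact: Ck_cst.
  have [_ D] := nchart_smooth k.+1 ((v \o pnat s) \o succn) fw cM.
  exact: D.
Qed.

End NatForms.

(** * Operations on differential forms and their compatibility with d *)

Section Forms.
Context (R : realType).
Implicit Types (M N L : manifold R) (U V W : vectType R).

Lemma is_formD M V p (w w' : preform M V p) :
  is_form w -> is_form w' -> is_form (w + w').
Proof.
move=> fw fw'; apply: is_formI => [x v i ip k a b|x v i j ip jp ij vij|c v k cM].
- rewrite -![nform _ _ _]/(nform w x _ + nform w' x _).
  by rewrite !(nform_mlin _ _) // scalerDr addrACA.
- rewrite -[nform _ _ _]/(nform w x v + nform w' x v).
  rewrite (nform_alternating x fw ip jp ij vij) add0r.
  exact: (nform_alternating x fw' ip jp ij vij).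
- have oc : open (cmap c @` cdom c) by exact: cimg_open.
  apply: (@Ck_eq _ _ _ _ _
    (fun u => coords (nchart w c u v) + coords (nchart w' c u v))) => //.
    by move=> u _; rewrite -(linD (@coords_linear _ _)).
  by apply: CkD => //; exact: nchart_smooth.
Qed.

Lemma is_form_postcomp M V W (f : V -> W) p (w : preform M V p) :
  linear f -> is_form w -> is_form (postcomp f w).
Proof.
move=> lf fw; apply: is_formI => [x v i ip k a b|x v i j ip jp ij vij|c v k cM].
- rewrite -![nform _ _ _]/(f (nform w x _)).
  by rewrite (nform_mlin _ _) // lf.
- rewrite -[nform _ _ _]/(f (nform w x v)).
  by rewrite (nform_alternating x fw ip jp ij vij) (lin0 lf).
- have oc : open (cmap c @` cdom c) by exact: cimg_open.
  exact: (Ck_lin (f := nchart w c ^~ v) oc lf (nchart_smooth k v fw cM)).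
Qed.

Lemma is_formZ M V p k (w : preform M V p) : is_form w -> is_form (k *: w).
Proof.
move=> fw; apply: (is_form_postcomp (f := *:%R k)) => // a x y.
by rewrite scalerDr !scalerA mulrC.
Qed.

Lemma is_formB M V p (w w' : preform M V p) :
  is_form w -> is_form w' -> is_form (w - w').
Proof.
move=> fw fw'; rewrite -scaleN1r; apply: is_formD => //; exact: is_formZ.
Qed.

Lemma is_form_cast M V p q (e : p = q) (w : preform M V p) :
  is_form w -> is_form (cast_form e w).
Proof.
by case: q / e => fw; rewrite (_ : cast_form _ _ = w) //; exact: nform_inj.
Qed.

Lemma nchart_wedge M U V W (B : U -> V -> W) p q (a : preform M U p)
    (b : preform M V q) c u v :
  nchart (wedge B a b) c u v = nwedge B p q (nchart a c u) (nchart b c u) v.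
Proof. by rewrite nchartE nform_wedge nwedge.unlock. Qed.

Lemma is_form_wedge M U V W (B : U -> V -> W) p q (a : preform M U p)
    (b : preform M V q) :
  (forall y, linear (B^~ y)) -> (forall x, linear (B x)) ->
  is_form a -> is_form b -> is_form (wedge B a b).
Proof.
move=> lBl lBr fa fb.
have E x : nform (wedge B a b) x = nwedge B p q (nform a x) (nform b x).
  by apply: funext => v; exact: nform_wedge.
apply: is_formI => [x|x|c v k cM].
- by rewrite E; apply: mlin_wedge => //; (exact: dep_nform || exact: nform_mlin).
- by rewrite E; exact: alternating_wedge.
have oc : open (cmap c @` cdom c) by exact: cimg_open.
under eq_fun => u.
  rewrite nchart_wedge nwedge.unlock (linZ (@coords_linear _ _)).
  rewrite /Alt (lin_sum (@coords_linear _ _)).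
  under eq_bigr => s _ do rewrite (linZ (@coords_linear _ _)).
  over.
apply: CkZ => //; first exact: Ck_cst.
apply: Ck_sum => // s; apply: CkZ => //; first exact: Ck_cst.
by apply: Ck_bilin => //; exact: nchart_smooth.
Qed.

Lemma is_form_pullback M N (f : M -> N) V p (w : preform N V p) :
  smooth_map f -> is_form w -> is_form (pullback f w).
Proof.
move=> sf fw; apply: is_formI => [x|x v i j ip jp ij vij|c v k cM].
- apply: (mlin_comp (f := mdiff f x) (nform_mlin (f x) fw)); exact: linearP.
- have := nform_alternating (f x) fw (v := fun i => mdiff f x (v i)) ip jp ij.
  by rewrite vij; exact.
(* The domain of c may not be mapped into a single chart of the target, so each point gets a chart
   around its image. *)
apply: Ck_local => u0 cu0; pose c' := chart_at (f (cinv c u0)).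
have c'N : matlas c' by exact: chart_at_atlas.
have oU : open (locdom f c c') by apply: open_locdom; exact: sf.1.
exists (locdom f c c').
  by apply/locdomP; split => //; exact: chart_at_dom.
have CF := loc_smooth k sf cM c'N.
(* The arguments of the pulled-back form are first derivatives of the local expression, hence one
   more order of smoothness. *)
have [dF DF] := loc_smooth k.+1 sf cM c'N.
pose g i := 'D_(v i) (loc f c c').
have lom y : mlin p (nchart w c' y) by exact: nchart_mlin.
apply: (@Ck_eq _ _ _ _ _ (fun u => coords (nchart w c' (loc f c c' u)
    (slots g p (fun=> 0) u)))) => //.
  move=> u fu; have [cu c'u] := (locdomP _ _ _ _).1 fu.
  rewrite (nchart_pullback w v sf cM c'N cu c'u); congr coords.
  apply: dep_nchart => j jp; rewrite /slots jp /g.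
  exact: deriveE (dF u fu).
apply: (@Ck_slots _ _ _ _ _ _ lom _ g _ _ _ _ (cmap c' @` cdom c')) => //.
- move=> u /locdomP[cu c'u]; exists (f (cinv c u)) => //.
- by move=> i _; exact: DF.
- by move=> v'; exact: nchart_smooth.
Qed.

Lemma dform_pullback M N (f : M -> N) V p (w : preform N V p) :
  smooth_map f -> is_form w -> dform (pullback f w) = pullback f (dform w).
Proof.
move=> sf fw; apply: nform_inj => x v.
apply: etrans (nform_dform _ _ (is_form_pullback sf fw)) _.
pose c := chart_at x; pose c' := chart_at (f x).
have cM : matlas c by exact: chart_at_atlas.
have c'N : matlas c' by exact: chart_at_atlas.
have e : loc f c c' (base x) = base (f x) by rewrite /loc /= cinv_base.
have fx : locdom f c c' (base x).
  apply/locdomP; split; first exact: base_img.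
  by rewrite cinv_base; exact: chart_at_dom.
have oU : open (locdom f c c') by apply: open_locdom; exact: sf.1.
apply: (@etrans _ _ (nD p (Dform (pull (loc f c c') (nchart w c')) (base x)) v)).
  apply: nD_near; apply: filterS (open_near oU fx) => u /locdomP[u1 u2] v'.
  exact: nchart_pullback.
apply: etrans (nD_pull v oU fx (loc_smooth 2 sf cM c'N) _ _ _) _.
- by move=> y; exact: nchart_mlin.
- by move=> y; exact: dep_nchart.
- move=> v'; apply: nchart_vdiff => //.
  by exists (f x); [exact: chart_at_dom|exact: esym e].
rewrite e.
exact: (esym (nform_dform (f x) (fun i => mdiff f x (v i)) fw)).
Qed.

Lemma dformD M V p (w w' : preform M V p) : is_form w -> is_form w' ->
  dform (w + w') = dform w + dform w'.
Proof.
move=> fw fw'; apply: funext => x; apply: funext => v.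
rewrite -[RHS]/(dform w x v + dform w' x v) -big_split.
apply: eq_bigr => i _; rewrite -[RHS]scalerDr; apply: (congr1 ( *:%R _)).
have D (z : preform M V p) : is_form z ->
    vdiff (fun u => in_chart z (chart_at x) u (fun j => v (lift i j))) (base x).
  move=> fz; have [d _] := form_smooth fz (fun j => v (lift i j))
    (chart_at_atlas x) 1.
  by apply: d; exact: base_img.
exact: vderiveD (D w fw) (D w' fw').
Qed.

Lemma dform_postcomp M V W (f : V -> W) p (w : preform M V p) : linear f ->
  is_form w -> dform (postcomp f w) = postcomp f (dform w).
Proof.
move=> lf fw; apply: funext => x; apply: funext => v.
rewrite -[RHS]/(f (dform w x v)) (lin_sum lf).
apply: eq_bigr => i _; rewrite (linZ lf); apply: (congr1 ( *:%R _)).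
apply: (vderive_lin (v i) lf).
have [d _] := form_smooth fw (fun j => v (lift i j)) (chart_at_atlas x) 1.
by apply: d; exact: base_img.
Qed.

Lemma dformZ M V p k (w : preform M V p) : is_form w ->
  dform (k *: w) = k *: dform w.
Proof.
move=> fw; apply: (dform_postcomp (f := *:%R k)) => // a x y.
by rewrite scalerDr !scalerA mulrC.
Qed.

Lemma dformB M V p (w w' : preform M V p) : is_form w -> is_form w' ->
  dform (w - w') = dform w - dform w'.
Proof.
move=> fw fw'.
have lN : linear (-%R : V -> V) by move=> k x y; rewrite opprD scalerN.
have fN : is_form (- w') by exact: (is_form_postcomp lN fw').
apply: etrans (dformD fw fN) _; apply: (congr1 (+%R (dform w))).
exact: (dform_postcomp lN fw').
Qed.

Lemma nform_dform_cast M V p q (e : p = q) (w : preform M V p) x v :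
  nform (dform (cast_form e w)) x v = nform (dform w) x v.
Proof.
case: q / e; congr (nform (dform _) x v); exact: nform_inj.
Qed.

Lemma vderive_nwedge n (T : Type) U V W (B : U -> V -> W) p q
    (a : 'rV[R]_n -> (nat -> T) -> U) (b : 'rV[R]_n -> (nat -> T) -> V) u h v :
  (forall y, linear (B^~ y)) -> (forall x, linear (B x)) ->
  (forall v, vdiff (a^~ v) u) -> (forall v, vdiff (b^~ v) u) ->
  vderive (fun u => nwedge B p q (a u) (b u) v) u h =
  nwedge B p q (fun w => vderive (a^~ w) u h) (b u) v +
  nwedge B p q (a u) (fun w => vderive (b^~ w) u h) v.
Proof.
move=> lBl lBr da db; rewrite nwedge.unlock.
have lZ k : linear ( *:%R k : W -> W).
  by move=> c x y; rewrite scalerDr !scalerA mulrC.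
have dB w w' : vdiff (fun u => B (a u w) (b u w')) u by exact: vdiff_bilin.
have dS w : vdiff (fun u => \sum_(s : 'S_(p + q)) (-1) ^+ s *:
    B (a u (w \o pnat s)) (b u ((w \o pnat s) \o addn p))) u.
  apply: vdiff_sum => s.
  exact: (vdiff_lin (f := fun u => B (a u _) (b u _)) (lZ _) (dB _ _)).
apply: etrans (vderive_lin h (lZ _) (dS v)) _.
rewrite -[RHS]scalerDr; apply: (congr1 ( *:%R _)).
apply: etrans (vderive_sum _ _ _) _ => [s|].
  exact: (vdiff_lin (f := fun u => B (a u _) (b u _)) (lZ _) (dB _ _)).
rewrite -[RHS]big_split; apply: eq_bigr => s _.
apply: etrans (vderive_lin (f := fun u => B (a u _) (b u _)) h (lZ _) (dB _ _)) _.
rewrite -[RHS]scalerDr; apply: (congr1 ( *:%R _)).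
exact: vderive_bilin.
Qed.

End Forms.

(** * The Leibniz rule for wedge products, and functoriality of pullback *)

Section Leibniz.
Context (R : realType).
Implicit Types (M N L : manifold R) (U V W : vectType R).

Lemma nform_dform_wedge M U V W (B : U -> V -> W) p q (a : preform M U p)
    (b : preform M V q) x v :
  (forall y, linear (B^~ y)) -> (forall x, linear (B x)) ->
  is_form a -> is_form b ->
  nform (dform (wedge B a b)) x v =
  nwedge B p.+1 q (nform (dform a) x) (nform b x) v +
  (-1) ^+ p *: nwedge B p q.+1 (nform a x) (nform (dform b) x) v.
Proof.
move=> lBl lBr fa fb; pose c := chart_at x.
have cM : matlas c by exact: chart_at_atlas.
have vd V' r (z : preform M V' r) : is_form z ->
    forall w, vdiff (nchart z c ^~ w) (base x).
  by move=> fz w; apply: nchart_vdiff => //; exact: base_img.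
have eqf V' r (z : preform M V' r) : nchart z c (base x) = nform z x.
  by apply: funext => w; exact: nchart_base.
have dD V' r (z : preform M V' r) h : dep r (Dform (nchart z c) (base x) h).
  move=> w w' ww; rewrite /Dform.
  apply: (congr1 (fun F => vderive F (base x) h)); apply: funext => u.
  exact: dep_nchart.
apply: etrans (nform_dform x v (is_form_wedge lBl lBr fa fb)) _.
apply: (@etrans _ _ (nD (p + q) (fun h w =>
    nwedge B p q (Dform (nchart a c) (base x) h) (nform b x) w +
    nwedge B p q (nform a x) (Dform (nchart b c) (base x) h) w) v)).
  apply: (congr1 ( *:%R _)); apply: eq_Alt => w.
  apply: (@etrans _ _ (vderive (fun u =>
      nwedge B p q (nchart a c u) (nchart b c u) (w \o succn)) (base x) (w 0%N))).
    apply: (congr1 (fun F => vderive F (base x) (w 0%N))).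
    by apply: funext => u; exact: nchart_wedge.
  have E := vderive_nwedge p q (w 0%N) (w \o succn) lBl lBr
    (vd _ _ _ fa) (vd _ _ _ fb).
  by apply: etrans E _; rewrite !eqf.
apply: etrans (nD_wedge _ lBl lBr _ _ (dD _ _ a) (dD _ _ b)) _.
- exact: dep_nform.
- exact: dep_nform.
have dE V' r (z : preform M V' r) : is_form z ->
    nD r (Dform (nchart z c) (base x)) = nform (dform z) x.
  by move=> fz; apply: funext => w; rewrite nform_dform.
by rewrite !dE.
Qed.

Lemma pullback_comp M N L (f : M -> N) (g : N -> L) V p (w : preform L V p) :
  smooth_map f -> smooth_map g ->
  pullback f (pullback g w) = pullback (g \o f) w.
Proof.
move=> sf sg; apply: funext => x; apply: funext => v.
by rewrite /pullback; congr (w _); apply: funext => i; rewrite mdiff_comp.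
Qed.

Lemma nform_pullback M N (f : M -> N) V p (w : preform N V p) x v :
  nform (pullback f w) x v = nform w (f x) (fun i => mdiff f x (v i)).
Proof. by []. Qed.

Lemma nform_pullback_wedge M N (f : M -> N) U V W (B : U -> V -> W) p q
    (a : preform N U p) (b : preform N V q) x v :
  nform (pullback f (wedge B a b)) x v =
  nwedge B p q (nform (pullback f a) x) (nform (pullback f b) x) v.
Proof. by rewrite nform_pullback nform_wedge nwedge.unlock. Qed.

End Leibniz.

Section Entries.
Context (R : realType) (V : vectType R).

(* Reading vectors through their coordinates reduces identities in [V] to the
   scope of [ring] and [lra]. *)
Definition ent (i : 'I_(\dim {:V})) (x : V) : R := coords x 0 i.

Lemma ent_inj (x y : V) : (forall i, ent i x = ent i y) -> x = y.
Proof. by move=> xy; apply: (can_inj (@coordsK R V)); apply/rowP. Qed.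

Lemma entD i x y : ent i (x + y) = ent i x + ent i y.
Proof. by rewrite /ent (linD (@coords_linear _ _)) mxE. Qed.

Lemma entN i x : ent i (- x) = - ent i x.
Proof. by rewrite /ent (linN (@coords_linear _ _)) mxE. Qed.

Lemma entZ i k x : ent i (k *: x) = k * ent i x.
Proof. by rewrite /ent (linZ (@coords_linear _ _)) mxE. Qed.

Lemma ent0 i : ent i 0 = 0.
Proof. by rewrite /ent (lin0 (@coords_linear _ _)) mxE. Qed.

Definition entE := (entD, entN, entZ, ent0).

End Entries.

Section Arguments.
Context (R : numFieldType) (T : Type).
Implicit Types (U V W X Y : lmodType R).

Lemma nwedge_compl U V W X (f : X -> U) (B : U -> V -> W) p q
    (a : (nat -> T) -> X) (b : (nat -> T) -> V) v :
  nwedge B p q (fun w => f (a w)) b v =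
  nwedge (fun x y => B (f x) y) p q a b v.
Proof. by rewrite nwedge.unlock. Qed.

Lemma nwedge_compr U V W X (f : X -> V) (B : U -> V -> W) p q
    (a : (nat -> T) -> U) (b : (nat -> T) -> X) v :
  nwedge B p q a (fun w => f (b w)) v =
  nwedge (fun x y => B x (f y)) p q a b v.
Proof. by rewrite nwedge.unlock. Qed.

Lemma nwedge_fun2 U V W (B B' : U -> V -> W) p q
    (a : (nat -> T) -> U) (b : (nat -> T) -> V) v :
  (forall x y, B x y = B' x y) -> nwedge B p q a b v = nwedge B' p q a b v.
Proof. by move=> BB; apply: eq_nwedge. Qed.

Lemma nwedge_anticomm U V W (B : U -> V -> W) (B' : V -> U -> W) p q
    (a : (nat -> T) -> U) (b : (nat -> T) -> V) v :
  (forall x y, B' y x = - B x y) -> dep p a -> dep q b ->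
  nwedge B' q p b a v = - ((-1) ^+ (p * q) *: nwedge B p q a b v).
Proof.
move=> BB da db; rewrite -(nwedge_comm B v da db) -nwedge_oppf.
by apply: eq_nwedge.
Qed.

End Arguments.

(** * Lie algebras and the semidirect product *)

Section LieAlgebra.
Context (R : realType) (G : lie_algebra R).

Lemma bracketC (x y : G) : bracket y x = - bracket x y.
Proof.
apply/eqP; rewrite -addr_eq0; apply/eqP.
have := bracket_alt (x + y).
rewrite (linD (bracket_linearl _)) !(linD (bracket_linearr _)) !bracket_alt.
by rewrite add0r addr0 addrC.
Qed.

Lemma bracket_jacobi_left (x y z : G) :
  bracket (bracket x y) z + bracket (bracket z x) y + bracket (bracket y z) x = 0.
Proof.
rewrite [bracket (bracket x y) z]bracketC [bracket (bracket z x) y]bracketC.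
rewrite [bracket (bracket y z) x]bracketC -!opprD addrAC [X in - X]addrAC.
have := bracket_jacobi x y z.
move=> J; apply/eqP; rewrite oppr_eq0 -J; apply/eqP.
by apply: ent_inj => i; rewrite !entE; ring.
Qed.

End LieAlgebra.

Section SemidirectProduct.
Context (R : realType) (G : lie2_algebra R).
Let g := lie2_g G.
Let h := lie2_h G.

(* The bracket of the semidirect product of [g] and [h]: with it, the pair
   (s^* a, b) attached to (a, b, c) is a form on Mor with values in a Lie
   algebra, and the product of forms becomes the wedge product of such pairs. *)
Definition sbracket (X Y : (g * h)%type) : (g * h)%type :=
  (bracket X.1 Y.1,
   bracket X.2 Y.2 + lie2_a X.1 Y.2 - lie2_a Y.1 X.2).

Lemma sbracket_linearl Y : linear (sbracket^~ Y).
Proof.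
move=> k [x y] [x' y']; rewrite /sbracket /=; congr pair.
  by rewrite (bracket_linearl Y.1).
rewrite (bracket_linearl Y.2) (lie2_a_linearl Y.2) (lie2_a_linearr Y.1).
by apply: ent_inj => i; rewrite !entE; ring.
Qed.

Lemma sbracket_jacobi X Y Z :
  sbracket (sbracket X Y) Z + sbracket (sbracket Z X) Y
  + sbracket (sbracket Y Z) X = 0.
Proof.
case: X Y Z => [x x'] [y y'] [z z']; rewrite /sbracket /=; congr pair => /=.
  exact: bracket_jacobi_left.
rewrite !(linB (bracket_linearl _)) !(linD (bracket_linearl _)).
rewrite !(linB (lie2_a_linearr _)) !(linD (lie2_a_linearr _)).
rewrite !lie2_a_action !lie2_a_derivation.
(* The derivation axiom yields brackets with the action in the second argument; turned around, they
   become the mixed terms of the other cyclic summands, and only a linear identity remains. *)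
rewrite [bracket x' (lie2_a z y')]bracketC [bracket z' (lie2_a y x')]bracketC.
rewrite [bracket y' (lie2_a x z')]bracketC.
have J := bracket_jacobi_left x' y' z'.
by apply: ent_inj => i; have := congr1 (ent i) J; rewrite !entE; lra.
Qed.

End SemidirectProduct.

(** * Forms on a Lie groupoid *)

Lemma signE (R : pzRingType) n : (-1) ^+ n = (if odd n then -1 else 1) :> R.
Proof. by rewrite -signr_odd; case: odd. Qed.

Section Delta.
Context (R : realType) (P : lie_groupoid R).
Implicit Types (V W : vectType R).

Lemma src_smooth : smooth_map (@src R P).
Proof. exact: (src_submersion P).1. Qed.

Lemma tgt_smooth : smooth_map (@tgt R P).
Proof. exact: (tgt_submersion P).1. Qed.

Lemma nform_Delta_obj V p (w : preform (Obj P) V p) x v :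
  nform (Delta_obj w) x v =
  nform (pullback (@tgt R P) w) x v - nform (pullback (@src R P) w) x v.
Proof. exact: erefl. Qed.

Lemma nform_Delta_mor V p (w : preform (Mor P) V p) x v :
  nform (Delta_mor w) x v =
  nform (pullback (@pr1 R P) w) x v - nform (pullback (@gcomp R P) w) x v
  + nform (pullback (@pr2 R P) w) x v.
Proof. exact: erefl. Qed.

Lemma is_form_Delta_obj V p (w : preform (Obj P) V p) :
  is_form w -> is_form (Delta_obj w).
Proof.
move=> fw; apply: is_formB; apply: is_form_pullback => //.
  exact: tgt_smooth.
exact: src_smooth.
Qed.

Lemma dform_Delta_obj V p (w : preform (Obj P) V p) :
  is_form w -> dform (Delta_obj w) = Delta_obj (dform w).
Proof.
move=> fw; rewrite /Delta_obj -!dform_pullback //; try exact: src_smooth;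
  try exact: tgt_smooth.
apply: dformB; apply: is_form_pullback => //; first exact: tgt_smooth.
exact: src_smooth.
Qed.

Lemma dform_Delta_mor V p (w : preform (Mor P) V p) :
  is_form w -> dform (Delta_mor w) = Delta_mor (dform w).
Proof.
move=> fw; have s1 := @pr1_smooth R P; have s2 := @pr2_smooth R P.
have sc := @gcomp_smooth R P.
have f1 : is_form (pullback (@pr1 R P) w) by exact: is_form_pullback.
have f2 : is_form (pullback (@pr2 R P) w) by exact: is_form_pullback.
have f3 : is_form (pullback (@gcomp R P) w) by exact: is_form_pullback.
rewrite /Delta_mor -!dform_pullback // dformD // ?dformB //.
exact: is_formB.
Qed.

Lemma pullback_pr1_src V p (w : preform (Obj P) V p) :
  pullback (@pr1 R P) (pullback (@src R P) w) =
  pullback (@pr2 R P) (pullback (@tgt R P) w).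
Proof.
rewrite (pullback_comp w (@pr1_smooth R P) src_smooth).
rewrite (pullback_comp w (@pr2_smooth R P) tgt_smooth).
apply: (congr1 (fun f => pullback f w)); apply: funext => x.
exact: set_mem (svalP x).
Qed.

Lemma pullback_gcomp_src V p (w : preform (Obj P) V p) :
  pullback (@gcomp R P) (pullback (@src R P) w) =
  pullback (@pr2 R P) (pullback (@src R P) w).
Proof.
rewrite (pullback_comp w (@gcomp_smooth R P) src_smooth).
rewrite (pullback_comp w (@pr2_smooth R P) src_smooth).
by apply: (congr1 (fun f => pullback f w)); apply: funext => x; exact: src_comp.
Qed.

Lemma pullback_gcomp_tgt V p (w : preform (Obj P) V p) :
  pullback (@gcomp R P) (pullback (@tgt R P) w) =
  pullback (@pr1 R P) (pullback (@tgt R P) w).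
Proof.
rewrite (pullback_comp w (@gcomp_smooth R P) tgt_smooth).
rewrite (pullback_comp w (@pr1_smooth R P) tgt_smooth).
by apply: (congr1 (fun f => pullback f w)); apply: funext => x; exact: tgt_comp.
Qed.

(** The six pullbacks cancel in pairs, because on composable pairs the source of the first arrow is
    the target of the second, and the composite keeps the outer source and target. *)
Lemma Delta_mor_obj V p (w : preform (Obj P) V p) :
  Delta_mor (Delta_obj w) = 0.
Proof.
have cancel6 (t1 s1 tc sc t2 s2 : V) : sc = s2 -> tc = t1 -> s1 = t2 ->
    t1 - s1 - (tc - sc) + (t2 - s2) = 0.
  by move=> -> -> ->; rewrite addrAC subrKA subrr.
apply: nform_inj => x v.
exact: (cancel6 _ _ _ _ _ _ (congr1 (fun z => nform z x v) (pullback_gcomp_src w))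
  (congr1 (fun z => nform z x v) (pullback_gcomp_tgt w))
  (congr1 (fun z => nform z x v) (pullback_pr1_src w))).
Qed.

End Delta.

(** * The differential, and the components of the product *)

Section GroupoidProduct.
Context (R : realType) (P : lie_groupoid R) (G : lie2_algebra R).
Let brg := @bracket R (lie2_g G).
Let brh := @bracket R (lie2_h G).
Let al := @lie2_a R G.
Let t := @lie2_t R G.
Let t_lin : linear t := @lie2_t_linear R G.

(** The terms added to d are compatible with the conditions: t_* commutes with Delta by linearity,
    and Delta composed with itself vanishes. *)
Lemma in_Omega_gD p (Psi : gpreform P G p) : in_Omega Psi -> in_Omega (gD Psi).
Proof.
case=> fa_ fb_ fc_ Da Db; have ft : is_form (postcomp t (fc Psi)).
  exact: is_form_postcomp t_lin fc_.
have fD := is_form_Delta_obj fc_.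
split.
- by apply: is_formB; [exact: is_form_dform|exact: is_formZ].
- by apply: is_formB; [exact: is_form_dform|exact: is_formZ].
- exact: is_form_dform.
- rewrite /fa /fb /gD /=.
  have E : Delta_obj (dform (fa Psi)) = postcomp t (dform (fb Psi)).
    by rewrite -dform_Delta_obj // Da dform_postcomp.
  have alg (X Y : lie2_g G) (Z c1 c2 : lie2_h G) e : X - Y = t Z ->
      X - e *: t c1 - (Y - e *: t c2) = t (Z - e *: (c1 - c2)).
    rewrite (linB t_lin) (linZ t_lin) (linB t_lin) => <-.
    by apply: ent_inj => i; rewrite !entE; ring.
  apply: nform_inj => x v.
  exact: (alg _ _ _ _ _ _ (congr1 (fun w => nform w x v) E)).
- rewrite /fb /gD /=.
  have E : Delta_mor (dform (fb Psi)) = 0.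
    rewrite -dform_Delta_mor // Db.
    (* The zero form is written as a form minus itself, so that its derivative vanishes by
       [dformB]. *)
    have f0 := is_form_pullback (@pr1_smooth R P) fb_.
    rewrite -(subrr (pullback (@pr1 R P) (fb Psi))) dformB // subrr //.
  have E' := Delta_mor_obj (fc Psi).
  have alg (d1 d2 d3 e1 e2 e3 : lie2_h G) e : d1 - d3 + d2 = 0 ->
      e1 - e3 + e2 = 0 -> d1 - e *: e1 - (d3 - e *: e3) + (d2 - e *: e2) = 0.
    move=> E1 E2; transitivity ((d1 - d3 + d2) - e *: (e1 - e3 + e2)).
      by apply: ent_inj => i; rewrite !entE; ring.
    by rewrite E1 E2 scaler0 subrr.
  apply: nform_inj => x v.
  exact: (alg _ _ _ _ _ _ _ (congr1 (fun w => nform w x v) E)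
    (congr1 (fun w => nform w x v) E')).
Qed.

Section Components.
Context (k l : nat) (Psi : gpreform P G k) (Phi : gpreform P G l).

Lemma fa_gwedge x v : nform (fa (gwedge Psi Phi)) x v =
  nwedge brg k l (nform (fa Psi) x) (nform (fa Phi) x) v.
Proof. exact: nform_wedge. Qed.

Lemma fb_gwedge x v : nform (fb (gwedge Psi Phi)) x v =
  nwedge brh k l (nform (fb Psi) x) (nform (fb Phi) x) v
  + nwedge al k l (nform (pullback (@src R P) (fa Psi)) x) (nform (fb Phi) x) v
  - (-1) ^+ (k * l) *:
    nwedge al l k (nform (pullback (@src R P) (fa Phi)) x) (nform (fb Psi) x) v.
Proof.
apply: (@etrans _ _ (nform (wedge brh (fb Psi) (fb Phi)) x v +
  nform (wedge al (pullback (@src R P) (fa Psi)) (fb Phi)) x v - (-1) ^+ (k * l) *: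
  nform (wedge al (pullback (@src R P) (fa Phi)) (fb Psi)) x v)).
  exact: erefl.
by rewrite !nform_wedge.
Qed.

Lemma fc_gwedge x v : nform (fc (gwedge Psi Phi)) x v =
  nwedge al k l.+1 (nform (fa Psi) x) (nform (fc Phi) x) v
  - (-1) ^+ (k * l) *:
    nwedge al l k.+1 (nform (fa Phi) x) (nform (fc Psi) x) v.
Proof.
apply: (@etrans _ _ (nform (wedge al (fa Psi) (fc Phi)) x v
  - (-1) ^+ (k * l) *: nform (wedge al (fa Phi) (fc Psi)) x v)).
  exact: erefl.
by rewrite !nform_wedge.
Qed.

End Components.

End GroupoidProduct.

(** * Pointwise identities of the product *)

Section Lie2Wedge.
Context (R : realType) (G : lie2_algebra R) (T : Type).
Let brg := @bracket R (lie2_g G).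
Let brh := @bracket R (lie2_h G).
Let al := @lie2_a R G.
Let t := @lie2_t R G.
Let t_lin : linear t := @lie2_t_linear R G.
Let al_l : forall y, linear (al^~ y) := @lie2_a_linearl R G.
Let al_r : forall x, linear (al x) := @lie2_a_linearr R G.
Let brg_l : forall y, linear (brg^~ y) := @bracket_linearl R (lie2_g G).
Let brg_r : forall x, linear (brg x) := @bracket_linearr R (lie2_g G).
Let brh_l : forall y, linear (brh^~ y) := @bracket_linearl R (lie2_h G).
Let brh_r : forall x, linear (brh x) := @bracket_linearr R (lie2_h G).

Implicit Types (A : (nat -> T) -> lie2_g G) (B C : (nat -> T) -> lie2_h G).

Lemma nwedge_at p q B B' v :
  nwedge al p q (fun w => t (B w)) B' v = nwedge brh p q B B' v.
Proof.
rewrite nwedge_compl; apply: nwedge_fun2 => x y; exact: lie2_peiffer.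
Qed.

Lemma t_nwedge_brh p q B B' v : t (nwedge brh p q B B' v) =
  nwedge brg p q (fun w => t (B w)) (fun w => t (B' w)) v.
Proof.
rewrite nwedge_compl nwedge_compr (nwedge_lin _ _ _ _ _ _ t_lin).
by apply: nwedge_fun2 => x y; exact: lie2_t_bracket.
Qed.

Lemma t_nwedge_al p q A B v : t (nwedge al p q A B v) =
  nwedge brg p q A (fun w => t (B w)) v.
Proof.
rewrite nwedge_compr (nwedge_lin _ _ _ _ _ _ t_lin).
by apply: nwedge_fun2 => x y; exact: lie2_equivariant.
Qed.

Lemma nwedge_brgC p q A A' v : dep p A -> dep q A' ->
  nwedge brg q p A' A v = - ((-1) ^+ (p * q) *: nwedge brg p q A A' v).
Proof. by move=> dA dA'; apply: nwedge_anticomm => // x y; exact: bracketC. Qed.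

Lemma nwedge_brhC p q B B' v : dep p B -> dep q B' ->
  nwedge brh q p B' B v = - ((-1) ^+ (p * q) *: nwedge brh p q B B' v).
Proof. by move=> dB dB'; apply: nwedge_anticomm => // x y; exact: bracketC. Qed.

Lemma dep_comp (U V : lmodType R) (f : U -> V) p (a : (nat -> T) -> U) :
  dep p a -> dep p (fun w => f (a w)).
Proof. by move=> da v w vw; rewrite (da v w). Qed.

(** The b-component of the product; [A] and [A'] stand for the source pullbacks of the a-components.
    As a function of its four factors it can also be evaluated on pullbacks to composable pairs. *)
Definition bprod k l A B A' B' v : lie2_h G :=
  nwedge brh k l B B' v + nwedge al k l A B' v
  - (-1) ^+ (k * l) *: nwedge al l k A' B v.

Definition cprod k l A C A' C' v : lie2_h G :=
  nwedge al k l.+1 A C' v - (-1) ^+ (k * l) *: nwedge al l k.+1 A' C v.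

Lemma eq_bprod k l A1 A2 B1 B2 A1' A2' B1' B2' v :
  A1 = A2 -> B1 = B2 -> A1' = A2' -> B1' = B2' ->
  bprod k l A1 B1 A1' B1' v = bprod k l A2 B2 A2' B2' v.
Proof. by move=> -> -> -> ->. Qed.

Lemma eq_cprod k l A1 A2 C1 C2 A1' A2' C1' C2' v :
  A1 = A2 -> C1 = C2 -> A1' = A2' -> C1' = C2' ->
  cprod k l A1 C1 A1' C1' v = cprod k l A2 C2 A2' C2' v.
Proof. by move=> -> -> -> ->. Qed.

Lemma dep_bprod k l A B A' B' : dep k A -> dep k B -> dep l A' -> dep l B' ->
  dep (k + l) (bprod k l A B A' B').
Proof.
move=> dA dB dA' dB' v w vw; rewrite /bprod.
rewrite (dep_nwedge brh dB dB' vw) (dep_nwedge al dA dB' vw).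
by rewrite addnC in vw; rewrite (dep_nwedge al dA' dB vw).
Qed.

(** The last term of [sbracket] takes its factors in the opposite order; reading it as a product of
    degrees l and k gives the sign in [bprod]. *)
Lemma nwedge_sbracket k l A B A' B' v : dep k B -> dep l A' ->
  nwedge (@sbracket R G) k l (fun w => (A w, B w)) (fun w => (A' w, B' w)) v =
  (nwedge brg k l A A' v, bprod k l A B A' B' v).
Proof.
move=> dB dA'; rewrite [LHS]surjective_pairing.
have lfst : linear (fst : lie2_g G * lie2_h G -> lie2_g G) by [].
have lsnd : linear (snd : lie2_g G * lie2_h G -> lie2_h G) by [].
rewrite (nwedge_lin _ _ _ _ _ _ lfst) (nwedge_lin _ _ _ _ _ _ lsnd).
apply: (congr2 pair); first by rewrite nwedge.unlock.
apply: etrans (nwedge_addf _ _ _ _ _ _ _) _.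
rewrite nwedge_oppf nwedge_addf /bprod [(k * l)%N]mulnC.
by rewrite -(nwedge_comm al v dA' dB) nwedge.unlock.
Qed.

Section TwoForms.
Context (k l : nat) (A A' : (nat -> T) -> lie2_g G).
Context (B B' C C' : (nat -> T) -> lie2_h G).
Context (dA : dep k A) (dA' : dep l A') (dB : dep k B) (dB' : dep l B').
Context (dC : dep k.+1 C) (dC' : dep l.+1 C').

(** With [A] for s^* a, the sum A + t B is t^* a, so the left-hand side is Delta of the a-component
    of the product. *)
Lemma Delta_bracket v :
  nwedge brg k l (fun w => A w + t (B w)) (fun w => A' w + t (B' w)) v
  - nwedge brg k l A A' v = t (bprod k l A B A' B' v).
Proof.
rewrite nwedgeDl // !nwedgeDr // (linB t_lin) (linD t_lin) (linZ t_lin).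
rewrite t_nwedge_brh !t_nwedge_al.
rewrite (@nwedge_brgC k l (fun w => t (B w)) A') //; last exact: dep_comp.
by apply: ent_inj => i; rewrite !entE signE; case: odd; ring.
Qed.

(** Read on composable pairs: [B] and [B2] are the pullbacks of b along the two projections, their
    sum is the one along composition, and [A2] is the pullback of a along the common source of the
    composite and of the second arrow. The source of the first arrow contributes A2 + t B2. *)
Lemma Delta_bprod A2 A2' B2 B2' v : dep k B2 -> dep l B2' ->
  bprod k l (fun w => A2 w + t (B2 w)) B (fun w => A2' w + t (B2' w)) B' v
  - bprod k l A2 (fun w => B w + B2 w) A2' (fun w => B' w + B2' w) v
  + bprod k l A2 B2 A2' B2' v = 0.
Proof.
move=> dB2 dB2'; rewrite /bprod !(nwedgeDl _ _ _ al_l) !(nwedgeDr _ _ _ al_r).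
rewrite !(nwedgeDl _ _ _ brh_l) !(nwedgeDr _ _ _ brh_r) !nwedge_at.
rewrite (@nwedge_brhC k l B B2') //.
by apply: ent_inj => i; rewrite !entE signE; case: odd; ring.
Qed.

Lemma bprodC v :
  bprod l k A' B' A B v = - ((-1) ^+ (k * l) *: bprod k l A B A' B' v).
Proof.
rewrite /bprod (@nwedge_brhC k l B B') // [(l * k)%N]mulnC.
by apply: ent_inj => i; rewrite !entE signE; case: odd; ring.
Qed.

Lemma cprodC v :
  cprod l k A' C' A C v = - ((-1) ^+ (k * l) *: cprod k l A C A' C' v).
Proof.
rewrite /cprod [(l * k)%N]mulnC.
by apply: ent_inj => i; rewrite !entE signE; case: odd; ring.
Qed.

Context (DA DA' : (nat -> T) -> lie2_g G) (DB DB' DC DC' : (nat -> T) -> lie2_h G).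

(** By equivariance, t applied to the c-component consists of brackets of a-components with t C and
    t C', which are the corrections occurring in [gD]. *)
Lemma Leibniz_a v :
  nwedge brg k.+1 l DA A' v + (-1) ^+ k *: nwedge brg k l.+1 A DA' v
  - (-1) ^+ (k + l) *: t (cprod k l A C A' C' v) =
  nwedge brg k.+1 l (fun w => DA w - (-1) ^+ k *: t (C w)) A' v
  + (-1) ^+ k *:
    nwedge brg k l.+1 A (fun w => DA' w - (-1) ^+ l *: t (C' w)) v.
Proof.
rewrite nwedgeBl // nwedgeBr // nwedgeZl // nwedgeZr //.
rewrite /cprod (linB t_lin) (linZ t_lin) !t_nwedge_al.
rewrite (@nwedge_brgC k.+1 l (fun w => t (C w)) A') //; last exact: dep_comp.
apply: ent_inj => i; rewrite !entE !signE !(oddM, oddD) /=.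
by case: (odd k); case: (odd l) => /=; ring.
Qed.

(** By the Peiffer identity the corrections t C and t C' produce brackets of C with C', one in each
    order; graded antisymmetry in degrees k + 1 and l + 1 makes them cancel. *)
Lemma Leibniz_c v :
  nwedge al k.+1 l.+1 DA C' v + (-1) ^+ k *: nwedge al k l.+2 A DC' v
  - (-1) ^+ (k * l) *: (nwedge al l.+1 k.+1 DA' C v
                        + (-1) ^+ l *: nwedge al l k.+2 A' DC v) =
  cprod k.+1 l (fun w => DA w - (-1) ^+ k *: t (C w)) DC A' C' v
  + (-1) ^+ k *:
    cprod k l.+1 A C (fun w => DA' w - (-1) ^+ l *: t (C' w)) DC' v.
Proof.
rewrite /cprod !(nwedgeBl _ _ _ al_l) !(nwedgeZl _ _ _ al_l) !nwedge_at.
rewrite (@nwedge_brhC k.+1 l.+1 C C') //.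
apply: ent_inj => i; rewrite !entE !signE !(oddM, oddD) /=.
by case: (odd k); case: (odd l) => /=; ring.
Qed.

(* [C0], [C0'] and [C], [C'] stand for the pullbacks of the c-components along
   the source and the target. *)
Lemma Leibniz_b C0 C0' v : dep l.+1 C0' ->
  (nwedge brh k.+1 l DB B' v + (-1) ^+ k *: nwedge brh k l.+1 B DB' v)
  + (nwedge al k.+1 l DA B' v + (-1) ^+ k *: nwedge al k l.+1 A DB' v)
  - (-1) ^+ (k * l) *: (nwedge al l.+1 k DA' B v
                        + (-1) ^+ l *: nwedge al l k.+1 A' DB v)
  - (-1) ^+ (k + l) *: (cprod k l (fun w => A w + t (B w)) C
                          (fun w => A' w + t (B' w)) C' v
                        - cprod k l A C0 A' C0' v) =
  bprod k.+1 l (fun w => DA w - (-1) ^+ k *: t (C0 w))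
    (fun w => DB w - (-1) ^+ k *: (C w - C0 w)) A' B' v
  + (-1) ^+ k *:
    bprod k l.+1 A B (fun w => DA' w - (-1) ^+ l *: t (C0' w))
      (fun w => DB' w - (-1) ^+ l *: (C' w - C0' w)) v.
Proof.
move=> dC0'; rewrite /cprod /bprod.
rewrite !(nwedgeBl _ _ _ al_l) !(nwedgeZl _ _ _ al_l) !(nwedgeDl _ _ _ al_l).
rewrite !(nwedgeBr _ _ _ al_r) !(nwedgeZr _ _ _ al_r) !(nwedgeBr _ _ _ al_r).
rewrite !(nwedgeBl _ _ _ brh_l) !(nwedgeZl _ _ _ brh_l) !(nwedgeBl _ _ _ brh_l).
rewrite !(nwedgeBr _ _ _ brh_r) !(nwedgeZr _ _ _ brh_r) !(nwedgeBr _ _ _ brh_r).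
(* The Peiffer identity turns every action through t into a bracket; two graded exchanges then put
   equal brackets in the same order, and only signs are left to compare. *)
rewrite !nwedge_at (@nwedge_brhC k.+1 l C B') //.
rewrite (@nwedge_brhC k l.+1 B C0') //.
apply: ent_inj => i; rewrite !entE !signE !(oddM, oddD) /=.
by case: (odd k); case: (odd l) => /=; ring.
Qed.

End TwoForms.

Section ThreeForms.
Context (k l m : nat) (A1 A2 A3 : (nat -> T) -> lie2_g G).
Context (B1 B2 B3 C1 C2 C3 : (nat -> T) -> lie2_h G).
Context (dA1 : dep k A1) (dA2 : dep l A2) (dA3 : dep m A3).
Context (dB1 : dep k B1) (dB2 : dep l B2) (dB3 : dep m B3).
Context (dC1 : dep k.+1 C1) (dC2 : dep l.+1 C2) (dC3 : dep m.+1 C3).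

Lemma jacobi_b v :
  (-1) ^+ (k * m) *: bprod (k + l) m (nwedge brg k l A1 A2)
    (bprod k l A1 B1 A2 B2) A3 B3 v
  + (-1) ^+ (l * m) *: bprod (m + k) l (nwedge brg m k A3 A1)
    (bprod m k A3 B3 A1 B1) A2 B2 v
  + (-1) ^+ (k * l) *: bprod (l + m) k (nwedge brg l m A2 A3)
    (bprod l m A2 B2 A3 B3) A1 B1 v = 0.
Proof.
have J := nwedge_jacobi v (@sbracket_linearl R G) (@sbracket_jacobi R G)
  (a := fun w => (A1 w, B1 w)) (b := fun w => (A2 w, B2 w))
  (c := fun w => (A3 w, B3 w)).
have E p q A B A' B' : dep p B -> dep q A' ->
    nwedge (@sbracket R G) p q (fun w => (A w, B w)) (fun w => (A' w, B' w)) =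
    fun v => (nwedge brg p q A A' v, bprod p q A B A' B' v).
  by move=> dB dA'; apply: funext => w; exact: nwedge_sbracket.
have {}J := J k l m _ _ _.
rewrite (E k l) // (E m k) // (E l m) // in J.
rewrite (E (k + l)%N m) // ?(E (m + k)%N l) // ?(E (l + m)%N k) // in J;
  try exact: dep_bprod.
apply: (congr1 snd (J _ _ _)) => w w' ww.
- by rewrite (dA1 ww) (dB1 ww).
- by rewrite (dA2 ww) (dB2 ww).
- by rewrite (dA3 ww) (dB3 ww).
Qed.

(** The action of a bracket splits into two double actions of a-components on a c-component; each of
    the six double actions then occurs twice, with opposite signs. *)
Lemma jacobi_c v :
  (-1) ^+ (k * m) *: cprod (k + l) m (nwedge brg k l A1 A2)
    (cprod k l A1 C1 A2 C2) A3 C3 v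
  + (-1) ^+ (l * m) *: cprod (m + k) l (nwedge brg m k A3 A1)
    (cprod m k A3 C3 A1 C1) A2 C2 v
  + (-1) ^+ (k * l) *: cprod (l + m) k (nwedge brg l m A2 A3)
    (cprod l m A2 C2 A3 C3) A1 C1 v = 0.
Proof.
have act := @lie2_a_action R G.
rewrite /cprod.
rewrite (nwedge_action v al_l al_r act dA1 dA2 dC3).
rewrite (nwedge_action v al_l al_r act dA3 dA1 dC2).
rewrite (nwedge_action v al_l al_r act dA2 dA3 dC1).
rewrite !addnS [(l + k)%N]addnC [(m + k)%N]addnC [(m + l)%N]addnC.
rewrite !(nwedgeBr _ _ _ al_r) !(nwedgeZr _ _ _ al_r).
apply: ent_inj => i; rewrite !entE !signE !(oddM, oddD) /=.
by case: (odd k); case: (odd l); case: (odd m) => /=; ring.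
Qed.

End ThreeForms.

End Lie2Wedge.

(** * The product on groupoid forms *)

Section GroupoidAlgebra.
Context (R : realType) (P : lie_groupoid R) (G : lie2_algebra R).
Let brg := @bracket R (lie2_g G).
Let brh := @bracket R (lie2_h G).
Let al := @lie2_a R G.
Let t := @lie2_t R G.
Let al_l : forall y, linear (al^~ y) := @lie2_a_linearl R G.
Let al_r : forall x, linear (al x) := @lie2_a_linearr R G.
Let brg_l : forall y, linear (brg^~ y) := @bracket_linearl R (lie2_g G).
Let brg_r : forall x, linear (brg x) := @bracket_linearr R (lie2_g G).
Let brh_l : forall y, linear (brh^~ y) := @bracket_linearl R (lie2_h G).
Let brh_r : forall x, linear (brh x) := @bracket_linearr R (lie2_h G).
Let s := @src R P.

Lemma gpreform_eq p (X Y : gpreform P G p) :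
  (forall x v, nform (fa X) x v = nform (fa Y) x v) ->
  (forall x v, nform (fb X) x v = nform (fb Y) x v) ->
  (forall x v, nform (fc X) x v = nform (fc Y) x v) -> X = Y.
Proof.
case: X => [[a b] c]; case: Y => [[a' b'] c'] ea eb ec.
exact: (congr2 pair (congr2 pair (nform_inj ea) (nform_inj eb)) (nform_inj ec)).
Qed.

Lemma nform_pullback_tgt p (Psi : gpreform P G p) f : in_Omega Psi ->
  nform (pullback (@tgt R P) (fa Psi)) f =
  fun w => nform (pullback s (fa Psi)) f w + t (nform (fb Psi) f w).
Proof.
move=> hPsi; apply: funext => w.
have E : nform (pullback (@tgt R P) (fa Psi)) f w
    - nform (pullback s (fa Psi)) f w = t (nform (fb Psi) f w).
  exact: (congr1 (fun z => nform z f w) (Omega_Delta_a hPsi)).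
by rewrite -E addrC subrK.
Qed.

Section Product.
Context (k l : nat) (Psi : gpreform P G k) (Phi : gpreform P G l).

Lemma nform_pullback_fa_gwedge (M : manifold R) (f : M -> Obj P) x v :
  nform (pullback f (fa (gwedge Psi Phi))) x v =
  nwedge brg k l (nform (pullback f (fa Psi)) x) (nform (pullback f (fa Phi)) x) v.
Proof. exact: nform_pullback_wedge. Qed.

Lemma nform_pullback_fb_gwedge (M : manifold R) (f : M -> Mor P) x v :
  nform (pullback f (fb (gwedge Psi Phi))) x v =
  bprod k l (nform (pullback f (pullback s (fa Psi))) x)
    (nform (pullback f (fb Psi)) x)
    (nform (pullback f (pullback s (fa Phi))) x)
    (nform (pullback f (fb Phi)) x) v.
Proof.
rewrite nform_pullback fb_gwedge /bprod nwedge.unlock.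
exact: erefl.
Qed.

Lemma nform_pullback_fc_gwedge (M : manifold R) (f : M -> Obj P) x v :
  nform (pullback f (fc (gwedge Psi Phi))) x v =
  cprod k l (nform (pullback f (fa Psi)) x) (nform (pullback f (fc Psi)) x)
    (nform (pullback f (fa Phi)) x) (nform (pullback f (fc Phi)) x) v.
Proof.
rewrite nform_pullback fc_gwedge /cprod nwedge.unlock.
exact: erefl.
Qed.

Context (hPsi : in_Omega Psi) (hPhi : in_Omega Phi).

Let fsPsi : is_form (pullback s (fa Psi)).
Proof. by apply: is_form_pullback; [exact: src_smooth|exact: Omega_a hPsi]. Qed.

Let fsPhi : is_form (pullback s (fa Phi)).
Proof. by apply: is_form_pullback; [exact: src_smooth|exact: Omega_a hPhi]. Qed.

Lemma in_Omega_gwedge : in_Omega (gwedge Psi Phi).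
Proof.
have [ fa1 fb1 fc1 _ Db1] := hPsi; have [ fa2 fb2 fc2 _ Db2] := hPhi.
split.
- exact: is_form_wedge.
- apply: is_formB; first by apply: is_formD; exact: is_form_wedge.
  by apply: is_formZ; apply: is_form_cast; exact: is_form_wedge.
- apply: is_formB; first by apply: is_form_cast; exact: is_form_wedge.
  by apply: is_formZ; apply: is_form_cast; exact: is_form_wedge.
- apply: nform_inj => f v; rewrite nform_Delta_obj.
  apply: etrans (congr2 (fun x y => x - y) _ (nform_pullback_fa_gwedge s f v)) _.
    apply: etrans (nform_pullback_fa_gwedge (@tgt R P) f v) _.
    exact: (congr2 (fun a b => nwedge brg k l a b v) (nform_pullback_tgt f hPsi)
      (nform_pullback_tgt f hPhi)).
  apply: etrans (Delta_bracket _ _ _ _ _) _; try exact: dep_nform.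
  exact: (congr1 t (esym (fb_gwedge Psi Phi f v))).
- apply: nform_inj => x v; rewrite nform_Delta_mor.
  (* These three facts express all pullbacks to composable pairs through the source of the second
     arrow and the two projections of the b-components, which is the situation of [Delta_bprod]. *)
  have E1 p (X : gpreform P G p) : in_Omega X ->
      nform (pullback (@pr1 R P) (pullback s (fa X))) x =
      fun w => nform (pullback (@pr2 R P) (pullback s (fa X))) x w
        + t (nform (pullback (@pr2 R P) (fb X)) x w).
    move=> hX; rewrite pullback_pr1_src; apply: funext => w.
    exact: (congr1 (@^~ (fun i => mdiff (@pr2 R P) x (w i)))
      (nform_pullback_tgt (pr2 x) hX)).
  have E2 p (X : gpreform P G p) : in_Omega X ->
      nform (pullback (@gcomp R P) (fb X)) x =
      fun w => nform (pullback (@pr1 R P) (fb X)) x w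
        + nform (pullback (@pr2 R P) (fb X)) x w.
    move=> hX; apply: funext => w.
    have E : nform (pullback (@pr1 R P) (fb X)) x w
        - nform (pullback (@gcomp R P) (fb X)) x w
        + nform (pullback (@pr2 R P) (fb X)) x w = 0.
      exact: (congr1 (fun z => nform z x w) (Omega_Delta_b hX)).
    by apply/eqP; rewrite eq_sym -subr_eq0 addrAC E.
  have E3 p (X : gpreform P G p) :
      nform (pullback (@gcomp R P) (pullback s (fa X))) x =
      nform (pullback (@pr2 R P) (pullback s (fa X))) x.
    exact: (congr1 (fun z => nform z x) (pullback_gcomp_src (fa X))).
  have Bf (f : pairs P -> Mor P) := nform_pullback_fb_gwedge f x v.
  apply: etrans (congr2 +%R (congr2 (fun x y => x - y)
    (etrans (Bf (@pr1 R P))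
      (eq_bprod k l v (E1 _ Psi hPsi) erefl (E1 _ Phi hPhi) erefl))
    (etrans (Bf (@gcomp R P))
      (eq_bprod k l v (E3 _ Psi) (E2 _ Psi hPsi) (E3 _ Phi) (E2 _ Phi hPhi))))
    (Bf (@pr2 R P))) _.
  apply: Delta_bprod; exact: dep_nform.
Qed.

Lemma gwedgeC :
  gcast (addnC l k) (gwedge Phi Psi) = - ((-1) ^+ (k * l) *: gwedge Psi Phi).
Proof.
apply: gpreform_eq => x v.
- apply: etrans (fa_gwedge Phi Psi x v) _.
  apply: (@etrans _ _ (- ((-1) ^+ (k * l) *: nform (fa (gwedge Psi Phi)) x v)));
    last exact: erefl.
  by rewrite fa_gwedge; apply: nwedge_brgC; exact: dep_nform.
- apply: etrans (fb_gwedge Phi Psi x v) _.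
  apply: (@etrans _ _ (- ((-1) ^+ (k * l) *: nform (fb (gwedge Psi Phi)) x v)));
    last exact: erefl.
  by rewrite fb_gwedge; apply: bprodC; exact: dep_nform.
- apply: etrans (fc_gwedge Phi Psi x v) _.
  apply: (@etrans _ _ (- ((-1) ^+ (k * l) *: nform (fc (gwedge Psi Phi)) x v)));
    last exact: erefl.
  by rewrite fc_gwedge; apply: cprodC; exact: dep_nform.
Qed.

Lemma nform_dform_fb_gwedge x v : nform (dform (fb (gwedge Psi Phi))) x v =
  (nwedge brh k.+1 l (nform (dform (fb Psi)) x) (nform (fb Phi) x) v
   + (-1) ^+ k *:
     nwedge brh k l.+1 (nform (fb Psi) x) (nform (dform (fb Phi)) x) v)
  + (nwedge al k.+1 l (nform (pullback s (dform (fa Psi))) x) (nform (fb Phi) x) v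
     + (-1) ^+ k *: nwedge al k l.+1 (nform (pullback s (fa Psi)) x)
                      (nform (dform (fb Phi)) x) v)
  - (-1) ^+ (k * l) *:
    (nwedge al l.+1 k (nform (pullback s (dform (fa Phi))) x) (nform (fb Psi) x) v
     + (-1) ^+ l *: nwedge al l k.+1 (nform (pullback s (fa Phi)) x)
                      (nform (dform (fb Psi)) x) v).
Proof.
have [ fa1 fb1 _ _ _] := hPsi; have [ fa2 fb2 _ _ _] := hPhi.
have f1 : is_form (wedge brh (fb Psi) (fb Phi)) by exact: is_form_wedge.
have f2 : is_form (wedge al (pullback s (fa Psi)) (fb Phi)).
  exact: is_form_wedge.
have f3 : is_form (wedge al (pullback s (fa Phi)) (fb Psi)).
  exact: is_form_wedge.
have f3c := is_form_cast (addnC l k) f3.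
have f3z := is_formZ ((-1) ^+ (k * l)) f3c.
apply: etrans (congr1 (fun z => nform z x v) (etrans
  (dformB (is_formD f1 f2) f3z)
  (congr2 (fun y z => y - z) (dformD f1 f2) (dformZ _ f3c)))) _.
apply: (@etrans _ _ (nform (dform (wedge brh (fb Psi) (fb Phi))) x v
  + nform (dform (wedge al (pullback s (fa Psi)) (fb Phi))) x v
  - (-1) ^+ (k * l) *: nform (dform (cast_form (addnC l k)
      (wedge al (pullback s (fa Phi)) (fb Psi)))) x v)); first exact: erefl.
apply: etrans (congr1 (fun z => _ - _ *: z) (nform_dform_cast _ _ _ _)) _.
apply: etrans (congr2 (fun y z => y - _ *: z) (congr2 +%R
  (nform_dform_wedge x v brh_l brh_r fb1 fb2)
  (nform_dform_wedge x v al_l al_r fsPsi fb2))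
  (nform_dform_wedge x v al_l al_r fsPhi fb1)) _.
by rewrite (dform_pullback (@src_smooth R P) fa1)
  (dform_pullback (@src_smooth R P) fa2).
Qed.

Lemma nform_dform_fc_gwedge x v : nform (dform (fc (gwedge Psi Phi))) x v =
  nwedge al k.+1 l.+1 (nform (dform (fa Psi)) x) (nform (fc Phi) x) v
  + (-1) ^+ k *:
    nwedge al k l.+2 (nform (fa Psi) x) (nform (dform (fc Phi)) x) v
  - (-1) ^+ (k * l) *:
    (nwedge al l.+1 k.+1 (nform (dform (fa Phi)) x) (nform (fc Psi) x) v
     + (-1) ^+ l *:
       nwedge al l k.+2 (nform (fa Phi) x) (nform (dform (fc Psi)) x) v).
Proof.
have [ fa1 _ fc1 _ _] := hPsi; have [ fa2 _ fc2 _ _] := hPhi.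
have f2 : is_form (wedge al (fa Psi) (fc Phi)) by exact: is_form_wedge.
have f3 : is_form (wedge al (fa Phi) (fc Psi)) by exact: is_form_wedge.
have f2c := is_form_cast (addnS k l) f2.
have f3c := is_form_cast (etrans (addnS l k) (congr1 S (addnC l k))) f3.
have f3z := is_formZ ((-1) ^+ (k * l)) f3c.
apply: etrans (congr1 (fun z => nform z x v) (etrans
  (dformB f2c f3z) (congr1 (fun z => _ - z) (dformZ _ f3c)))) _.
apply: etrans (congr2 (fun y z => y - _ *: z)
  (etrans (nform_dform_cast _ _ _ _) (nform_dform_wedge x v al_l al_r fa1 fc2))
  (etrans (nform_dform_cast _ _ _ _) (nform_dform_wedge x v al_l al_r fa2 fc1))) _.
exact: erefl.
Qed.

Lemma gD_gwedge : gD (gwedge Psi Phi)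
  = gcast (addSn k l) (gwedge (gD Psi) Phi)
    + (-1) ^+ k *: gcast (addnS k l) (gwedge Psi (gD Phi)).
Proof.
have [ fa1 fb1 fc1 _ _] := hPsi; have [ fa2 fb2 fc2 _ _] := hPhi.
apply: gpreform_eq => x v.
- apply: (@etrans _ _ (nform (dform (fa (gwedge Psi Phi))) x v -
    (-1) ^+ (k + l) *: t (nform (fc (gwedge Psi Phi)) x v))); first exact: erefl.
  apply: (@etrans _ _ (nform (fa (gwedge (gD Psi) Phi)) x v +
    (-1) ^+ k *: nform (fa (gwedge Psi (gD Phi))) x v)); last exact: erefl.
  apply: etrans (congr2 (fun y z => y - (-1) ^+ (k + l) *: t z)
    (nform_dform_wedge x v brg_l brg_r fa1 fa2) (fc_gwedge Psi Phi x v)) _.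
  apply: etrans (esym (congr2 (fun y z => y + (-1) ^+ k *: z)
    (fa_gwedge (gD Psi) Phi x v) (fa_gwedge Psi (gD Phi) x v))).
  apply: etrans (Leibniz_a _ _ _ _ _ _ _) _; try exact: dep_nform.
  exact: erefl.
- apply: (@etrans _ _ (nform (dform (fb (gwedge Psi Phi))) x v -
    (-1) ^+ (k + l) *: (nform (pullback (@tgt R P) (fc (gwedge Psi Phi))) x v
                        - nform (pullback s (fc (gwedge Psi Phi))) x v))).
    exact: erefl.
  apply: (@etrans _ _ (nform (fb (gwedge (gD Psi) Phi)) x v +
    (-1) ^+ k *: nform (fb (gwedge Psi (gD Phi))) x v)); last exact: erefl.
  (* Delta of the c-component contains target pullbacks of the a-components; the conditions defining
     forms on the groupoid replace them by source pullbacks plus t of the b-components, the shape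
     used in [Leibniz_b]. *)
  apply: etrans (congr2 (fun y z => y - (-1) ^+ (k + l) *: z)
    (nform_dform_fb_gwedge x v) (congr2 (fun y z => y - z)
    (etrans (nform_pullback_fc_gwedge (@tgt R P) x v)
      (eq_cprod k l v (nform_pullback_tgt x hPsi) erefl (nform_pullback_tgt x hPhi) erefl))
    (nform_pullback_fc_gwedge s x v))) _.
  apply: etrans (esym (congr2 (fun y z => y + (-1) ^+ k *: z)
    (fb_gwedge (gD Psi) Phi x v) (fb_gwedge Psi (gD Phi) x v))).
  apply: etrans (@Leibniz_b _ _ _ _ _ _ _ _ _ _ _ _ _ _
    (nform (pullback s (dform (fa Psi))) x) (nform (pullback s (dform (fa Phi))) x)
    (nform (dform (fb Psi)) x) (nform (dform (fb Phi)) x)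
    (nform (pullback s (fc Psi)) x) (nform (pullback s (fc Phi)) x) _ _) _;
    try exact: dep_nform.
  exact: erefl.
- apply: (@etrans _ _ (nform (dform (fc (gwedge Psi Phi))) x v)); first exact: erefl.
  apply: (@etrans _ _ (nform (fc (gwedge (gD Psi) Phi)) x v +
    (-1) ^+ k *: nform (fc (gwedge Psi (gD Phi))) x v)); last exact: erefl.
  apply: etrans (nform_dform_fc_gwedge x v) _.
  apply: etrans (esym (congr2 (fun y z => y + (-1) ^+ k *: z)
    (fc_gwedge (gD Psi) Phi x v) (fc_gwedge Psi (gD Phi) x v))).
  apply: etrans (@Leibniz_c _ _ _ _ _ _ _ _ _ _ _
    (nform (dform (fa Psi)) x) (nform (dform (fa Phi)) x)
    (nform (dform (fc Psi)) x) (nform (dform (fc Phi)) x) _) _;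
    try exact: dep_nform.
  exact: erefl.
Qed.

End Product.

Lemma gwedge_jacobi k l i (Psi : gpreform P G k) (Phi : gpreform P G l)
    (Xi : gpreform P G i) :
  (-1) ^+ (k * i) *: gwedge (gwedge Psi Phi) Xi
  + (-1) ^+ (l * i) *: gcast (add_rot1 k l i) (gwedge (gwedge Xi Psi) Phi)
  + (-1) ^+ (k * l) *: gcast (add_rot2 k l i) (gwedge (gwedge Phi Xi) Psi) = 0.
Proof.
have Ea p q (X : gpreform P G p) (Y : gpreform P G q) x :
    nform (fa (gwedge X Y)) x = nwedge brg p q (nform (fa X) x) (nform (fa Y) x).
  by apply: funext => v; exact: fa_gwedge.
(* In a nested product, the inner factor also enters the b-component through the source pullback of
   its own a-component. *)
have Es p q (X : gpreform P G p) (Y : gpreform P G q) x :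
    nform (pullback s (fa (gwedge X Y))) x =
    nwedge brg p q (nform (pullback s (fa X)) x) (nform (pullback s (fa Y)) x).
  by apply: funext => v; exact: nform_pullback_wedge.
have Eb p q (X : gpreform P G p) (Y : gpreform P G q) x :
    nform (fb (gwedge X Y)) x =
    bprod p q (nform (pullback s (fa X)) x) (nform (fb X) x)
      (nform (pullback s (fa Y)) x) (nform (fb Y) x).
  by apply: funext => v; exact: fb_gwedge.
have Ec p q (X : gpreform P G p) (Y : gpreform P G q) x :
    nform (fc (gwedge X Y)) x =
    cprod p q (nform (fa X) x) (nform (fc X) x) (nform (fa Y) x) (nform (fc Y) x).
  by apply: funext => v; exact: fc_gwedge.
apply: gpreform_eq => x v.
- apply: (@etrans _ _ (
    (-1) ^+ (k * i) *: nform (fa (gwedge (gwedge Psi Phi) Xi)) x v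
    + (-1) ^+ (l * i) *: nform (fa (gwedge (gwedge Xi Psi) Phi)) x v
    + (-1) ^+ (k * l) *: nform (fa (gwedge (gwedge Phi Xi) Psi)) x v));
    first exact: erefl.
  rewrite !Ea; apply: nwedge_jacobi => //; try exact: dep_nform.
  exact: bracket_jacobi_left.
- apply: (@etrans _ _ (
    (-1) ^+ (k * i) *: nform (fb (gwedge (gwedge Psi Phi) Xi)) x v
    + (-1) ^+ (l * i) *: nform (fb (gwedge (gwedge Xi Psi) Phi)) x v
    + (-1) ^+ (k * l) *: nform (fb (gwedge (gwedge Phi Xi) Psi)) x v));
    first exact: erefl.
  rewrite !Eb !Es.
  by apply: jacobi_b; exact: dep_nform.
- apply: (@etrans _ _ (
    (-1) ^+ (k * i) *: nform (fc (gwedge (gwedge Psi Phi) Xi)) x v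
    + (-1) ^+ (l * i) *: nform (fc (gwedge (gwedge Xi Psi) Phi)) x v
    + (-1) ^+ (k * l) *: nform (fc (gwedge (gwedge Phi Xi) Psi)) x v));
    first exact: erefl.
  rewrite !Ec !Ea.
  by apply: jacobi_c; exact: dep_nform.
Qed.

End GroupoidAlgebra.

Theorem lemma4p1p2 (R : realType) (P : lie_groupoid R) (G : lie2_algebra R)
    (k l i : nat)
    (Psi : gpreform P G k) (Phi : gpreform P G l) (Xi : gpreform P G i)
    (hPsi : in_Omega Psi) (hPhi : in_Omega Phi) (hXi : in_Omega Xi) :
  [/\ in_Omega (gD Psi) /\ in_Omega (gwedge Psi Phi),
      gcast (addnC l k) (gwedge Phi Psi)
        = - ((-1) ^+ (k * l) *: gwedge Psi Phi),
      (-1) ^+ (k * i) *: gwedge (gwedge Psi Phi) Xi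
        + (-1) ^+ (l * i) *:
            gcast (add_rot1 k l i) (gwedge (gwedge Xi Psi) Phi)
        + (-1) ^+ (k * l) *:
            gcast (add_rot2 k l i) (gwedge (gwedge Phi Xi) Psi) = 0
    & gD (gwedge Psi Phi)
        = gcast (addSn k l) (gwedge (gD Psi) Phi)
          + (-1) ^+ k *: gcast (addnS k l) (gwedge Psi (gD Phi)) ].
Proof.
split; first by split; [exact: in_Omega_gD|exact: in_Omega_gwedge].
- exact: gwedgeC.
- exact: gwedge_jacobi.
- exact: gD_gwedge.
Qed.
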